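(* Let $B$ be a body and let $P$ be a $G_{1C}$-structure on $B$, i.e. the structure given by a nowhere vanishing one-form $\omega$, a nowhere vanishing vector field $X$ such that $\omega(X)=0$, and a volume form $\Omega$. Then $P$ is integrable if and only if $\omega$ is closed and $\mathcal{L}_X\Omega=0$.
   Context: A body is a $3$-dimensional smooth manifold which can be covered with one chart. $G_{1C}\subset GL(3,\mathbb{R})$ is the isotropy group of the tensors $e_3$, $e^1$ and $e^1\wedge e^2\wedge e^3$, where $(e_i)$ is the canonical basis of $\mathbb{R}^3$ and $(e^i)$ its dual basis. The corresponding $G_{1C}$-structure $P$ is the set of linear frames $(v_1,v_2,v_3)$ at points $x\in B$ such that $v_3=X(x)$, $\omega(v_1)=1$, $\omega(v_2)=\omega(v_3)=0$ and $\Omega(v_1,v_2,v_3)=1$. A $G$-structure $P$ is integrable if around each point there are local coordinates $(x^1,x^2,x^3)$ whose coordinate frame is a section of $P$. $\mathcal{L}$ denotes the Lie derivative. *)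

(* Defs.v *)
From HB Require Import structures.
From mathcomp Require Import all_boot all_order all_algebra.
From mathcomp Require Import all_classical all_reals all_analysis.

Set Implicit Arguments.
Unset Strict Implicit.
Unset Printing Implicit Defensive.

Import Order.TTheory GRing.Theory Num.Theory.
Import numFieldNormedType.Exports.

Local Open Scope classical_set_scope.
Local Open Scope ring_scope.

Notation vect R := 'rV[R]_3.
Notation basis_vect i := (delta_mx 0 i).

Definition iter_partial (R : realType) (s : seq 'I_3) (f : vect R -> R) :
    vect R -> R :=
  foldr (fun i g => 'D_(basis_vect i) g) f s.

(* All partial derivatives of all orders exist and are continuous on [W],
   which is meant to be open. *)
Definition smooth_on (R : realType) (W : set (vect R)) (f : vect R -> R) :=
  forall (s : seq 'I_3) (z : vect R), W z ->
    {for z, continuous (iter_partial s f)} /\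
    forall i : 'I_3, derivable (iter_partial s f) z (basis_vect i).

Definition smooth_map_on (R : realType) (W : set (vect R))
    (F : vect R -> vect R) :=
  forall k : 'I_3, smooth_on W (fun z => F z 0 k).

(* A 3-dimensional manifold covered by one chart: a set with a bijection onto
   an open subset of R^3, carrying the topology and the smooth structure that
   this chart induces. *)
Record body (R : realType) := Body {
  point :> Type;
  chart : point -> vect R;
  chart_inj : injective chart;
  chart_open : open (range chart) }.

Arguments chart {R} b _.

Section Body.
Variables (R : realType) (B : body R).

Definition body_open (V : set B) := open (chart B @` V).

(* [f \o chart^-1], extended by 0 outside the range of the chart. *)
Definition in_chart (f : B -> R) (z : vect R) : R :=
  if pselect (exists p : B, chart B p = z) is left h then f (projT1 (cid h))
  else 0.

Lemma in_chartE (f : B -> R) (p : B) : in_chart f (chart B p) = f p.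
Proof.
rewrite /in_chart; case: pselect => [h|[]]; last by exists p.
by case: cid => q /= /(@chart_inj _ B) ->.
Qed.

Definition smooth_fun_on (V : set B) (f : B -> R) :=
  smooth_on (chart B @` V) (in_chart f).

(* Tangent vectors are given by their components in the coordinate basis of
   the global chart; vector fields and forms likewise. *)
Definition vector_field := B -> vect R.

Definition one_form := B -> {linear vect R -> R^o}.

Record alternating3 := Alternating3 {
  alt3 :> vect R -> vect R -> vect R -> R;
  alt3_linear1 : forall v w, linear (fun u => alt3 u v w : R^o);
  alt3_linear2 : forall u w, linear (fun v => alt3 u v w : R^o);
  alt3_linear3 : forall u v, linear (fun w => alt3 u v w : R^o);
  alt3_12 : forall u w, alt3 u u w = 0;
  alt3_23 : forall u v, alt3 u v v = 0;
  alt3_13 : forall u v, alt3 u v u = 0 }.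

Definition three_form := B -> alternating3.

Definition smooth_vector_field (X : vector_field) :=
  forall k : 'I_3, smooth_fun_on setT (fun p => X p 0 k).

Definition smooth_one_form (omega : one_form) :=
  forall k : 'I_3, smooth_fun_on setT (fun p => omega p (basis_vect k)).

Definition smooth_three_form (Omega : three_form) :=
  forall i j k : 'I_3, smooth_fun_on setT
    (fun p => Omega p (basis_vect i) (basis_vect j) (basis_vect k)).

Definition nowhere_zero_vector_field (X : vector_field) :=
  forall p, X p != 0.

Definition nowhere_zero_one_form (omega : one_form) :=
  forall p, exists v, omega p v != 0.

Definition volume_form (Omega : three_form) :=
  smooth_three_form Omega /\ forall p, exists u v w, Omega p u v w != 0.

Definition vf_act (X : vector_field) (f : B -> R) (p : B) : R :=
  'D_(X p) (in_chart f) (chart B p).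

Definition bracket (X Y : vector_field) : vector_field := fun p =>
  \row_k (vf_act X (fun q => Y q 0 k) p - vf_act Y (fun q => X q 0 k) p).

Definition ext_deriv (omega : one_form) (Y Z : vector_field) (p : B) : R :=
  vf_act Y (fun q => omega q (Z q)) p - vf_act Z (fun q => omega q (Y q)) p
  - omega p (bracket Y Z p).

Definition closed_one_form (omega : one_form) :=
  forall Y Z : vector_field, smooth_vector_field Y -> smooth_vector_field Z ->
  forall p, ext_deriv omega Y Z p = 0.

Definition lie_deriv (X : vector_field) (Omega : three_form)
    (Y1 Y2 Y3 : vector_field) (p : B) : R :=
  vf_act X (fun q => Omega q (Y1 q) (Y2 q) (Y3 q)) p
  - Omega p (bracket X Y1 p) (Y2 p) (Y3 p)
  - Omega p (Y1 p) (bracket X Y2 p) (Y3 p)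
  - Omega p (Y1 p) (Y2 p) (bracket X Y3 p).

Definition lie_deriv_zero (X : vector_field) (Omega : three_form) :=
  forall Y1 Y2 Y3 : vector_field, smooth_vector_field Y1 ->
    smooth_vector_field Y2 -> smooth_vector_field Y3 ->
  forall p, lie_deriv X Omega Y1 Y2 Y3 p = 0.

(* The frame (v_1, v_2, v_3) is [(v 0, v 1, v 2)]. *)
Definition frame := 'I_3 -> vect R.

Definition linear_frame (v : frame) := row_free (\matrix_i v i).

Definition frame_set := B -> set frame.

Definition G1C_structure (omega : one_form) (X : vector_field)
    (Omega : three_form) : frame_set := fun p =>
  [set v | [/\ linear_frame v,
               v 2 = X p,
               [/\ omega p (v 0) = 1, omega p (v 1) = 0 & omega p (v 2) = 0] &
               Omega p (v 0) (v 1) (v 2) = 1]].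

(* [x] is a diffeomorphism from the open set [V] onto an open subset of R^3,
   and [y] is [x^-1] read in the global chart. *)
Definition local_coordinates (V : set B) (x : B -> vect R)
    (y : vect R -> vect R) :=
  [/\ body_open V,
      open (x @` V),
      forall k : 'I_3, smooth_fun_on V (fun p => x p 0 k),
      smooth_map_on (x @` V) y &
      forall p, V p -> y (x p) = chart B p].

Definition coordinate_frame (x : B -> vect R) (y : vect R -> vect R)
    (p : B) : frame := fun j =>
  \row_k 'D_(basis_vect j) (fun z => y z 0 k) (x p).

Definition integrable_structure (P : frame_set) :=
  forall p : B, exists (V : set B) (x : B -> vect R) (y : vect R -> vect R),
    [/\ V p, local_coordinates V x y &
        forall q, V q -> P q (coordinate_frame x y q)].

End Body.

(* Main.v *)
(* No flow of X is needed.  If dw = 0, then w = df locally, and f has a nonzero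
   partial derivative in some direction i, so f can replace the i-th coordinate.
   Since A = rho X (rho the density of Omega) is divergence free and tangent to
   the leaves f = const, the 2-form i_X Omega is df /\ dg, where g is found by
   the Poincare lemma on the leaves with f as a parameter; g can replace a
   second coordinate j.  Finally X = X_k d/dx_k in the coordinates (f, g, x_k),
   and the primitive t of 1 / X_k along the last coordinate satisfies X t = 1.
   Then w = df, X = d/dt and i_X Omega = df /\ dg give Omega = df /\ dg /\ dt.
   Only integration with parameters and the one-variable implicit function
   theorem are used.
   Conversely, if w = df, X = d/dt and Omega = df /\ dg /\ dt, then rho X is the
   cross product of the gradients of f and g, and both equations follow from
   the symmetry of second derivatives. *)
From HB Require Import structures.
Require Import Defs.
From mathcomp Require Import all_boot all_order all_algebra.
From mathcomp Require Import all_classical all_reals all_analysis.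
From mathcomp Require Import ring lra.

Set Implicit Arguments.
Unset Strict Implicit.
Unset Printing Implicit Defensive.

Import Order.TTheory GRing.Theory Num.Theory.
Import numFieldNormedType.Exports.

Local Open Scope classical_set_scope.
Local Open Scope ring_scope.

(** * C^1 functions on open subsets of R^3 *)

Section Slopes.
Variable R : realType.
Implicit Types (f : vect R -> R) (x v z : vect R) (c t : R).

(** [smooth_on] speaks of iterated partial derivatives only, so the chain rule and the symmetry of
    second derivatives are derived from the mean value theorem. The indices are chosen at the given
    point with [w_i] and [X_k] non-zero; [omega(X) = 0] makes [k] different from [i] possible, and
    [j] is the remaining index. On a leaf [f = const], with coordinates [x_j] and [x_k], the
    differential of [g] has to be [(A_k dx_j - A_j dx_k) / w_i]; its closedness is where [dw = 0],
    [omega(X) = 0] and [div A = 0] meet. In the coordinates [(f, g, x_k)] only the last component of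
    [X] survives: [X f = omega(X) = 0], and [X g = 0] because the form above kills [A]. Each step
    replaces a single coordinate, so the Jacobian of its inverse is explicit, and the frame
    conditions become identities between rational expressions. The triple [(i, j, k)] may be an odd
    permutation; the density is taken as [Omega(e_i, e_j, e_k)] and determinants in the same order,
    so that no sign appears. *)

Lemma cvg_vect (T : Type) (F : set_system T) (FF : Filter F) (G : T -> vect R)
    (l : vect R) :
  (forall k, (fun p => G p 0 k) @ F --> l 0 k) -> G @ F --> l.
Proof.
move=> Gl; apply/cvg_ballP => e e0.
rewrite near_simpl /=.
suff: \forall x \near F, forall k, ball (l 0 k) e (G x 0 k).
  by apply: filterS => x h; split=> // i j; rewrite (ord1 i).
by apply: filter_forall => k; exact: (cvg_ball (Gl k) e0).
Qed.

Lemma continuous_vect (T : topologicalType) (G : T -> vect R) (x : T) :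
  (forall k, {for x, continuous (fun p => G p 0 k)}) -> {for x, continuous G}.
Proof. by move=> Gc; apply: cvg_vect => k; exact: Gc. Qed.

Lemma continuous_dist (T : topologicalType) (g : T -> R) (x : T) :
  {for x, continuous g} <->
  forall e, 0 < e -> \forall y \near x, `|g x - g y| < e.
Proof.
split=> [gx e e0|gx]; first by move/cvgrPdist_lt : gx; exact.
by apply/cvgrPdist_lt => e e0; exact: gx.
Qed.

Lemma near_ball z (r : R) : 0 < r -> \forall z' \near z, ball z r z'.
Proof. by move=> r0; exact: nbhsx_ballx. Qed.

Lemma is_derive_line f x v t : derivable f (t *: v + x) v ->
  is_derive t (1 : R) (fun s => f (s *: v + x)) ('D_v f (t *: v + x)).
Proof.
move=> df.
have E : (fun h : R => h^-1 *:
    (((fun s => f (s *: v + x)) \o shift t) (h *: (1 : R)) - f (t *: v + x))) =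
  (fun h => h^-1 *: ((f \o shift (t *: v + x)) (h *: v) - f (t *: v + x))).
  by apply/funext => h /=; rewrite [h *: (1 : R)]mulr1 scalerDl addrA.
by split; rewrite /derivable /derive E.
Qed.

(** Homogeneity in the direction needs no differentiability of [f]: on the line through [x] it is
    the one-variable chain rule for [s |-> c * s]. The case [c = 0] is included. *)
Lemma is_derive_scale f x v c : derivable f x v ->
  is_derive x (c *: v) f (c * 'D_v f x).
Proof.
move=> df.
have d0 : derivable f (0 *: v + x) v by rewrite scale0r add0r.
have := is_derive_line d0; rewrite scale0r add0r => d1.
have d2 : is_derive (0 : R) 1 ( *%R c) c.
  have -> : ( *%R c : R -> R) = c \*: id by [].
  apply: is_derive_eq; by rewrite [LHS]mulr1.
rewrite -(mulr0 c) in d1.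
have d3 := @is_derive1_comp _ (fun s => f (s *: v + x)) ( *%R c) 0 _ _ d1 d2.
have E : (fun s => f (s *: v + x)) \o *%R c = (fun s => f (s *: (c *: v) + x)).
  by apply/funext => s /=; rewrite scalerA mulrC.
rewrite E in d3.
have [d4 d5] := d3; split; first exact: (iffRL (derivable1P f x (c *: v)) d4).
rewrite mulrC -d5.
rewrite /derive; set g1 := fun h => h^-1 *: _; set g2 := fun h => h^-1 *: _.
suff -> : g1 = g2 by [].
by apply/funext => h; rewrite /g1 /g2 /= addr0 scale0r add0r [h%:A]mulr1.
Qed.

Lemma MVT_line f x v :
  (forall t : R, 0 <= t <= 1 -> derivable f (t *: v + x) v) ->
  exists2 t : R, 0 <= t <= 1 & f (v + x) - f x = 'D_v f (t *: v + x).
Proof.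
move=> df; pose g (s : R) := f (s *: v + x).
have dg t : 0 <= t <= 1 -> is_derive t 1 g ('D_v f (t *: v + x)).
  by move=> t01; apply: is_derive_line; apply: df.
have [||t] := @MVT_segment R g (fun t => 'D_v f (t *: v + x)) 0 1 ler01.
- by move=> t; rewrite in_itv /= => /andP[t0 t1]; apply: dg; rewrite !ltW.
- apply: derivable_within_continuous => t; rewrite in_itv /= => t01.
  by case: (dg t t01).
- rewrite in_itv /= subr0 mulr1 /g scale1r scale0r add0r => t01 E.
  by exists t.
Qed.

Lemma ball_vectP z r z' : 0 < r ->
  ball z r z' <-> forall k, `|z 0 k - z' 0 k| < r.
Proof.
move=> r0; split=> [[_ h] k|h]; first exact: (h 0 k).
by split=> // i j; rewrite (ord1 i); exact: h.
Qed.

(* Caratheodory's form of differentiability. *)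
Lemma C1_slopes (U : set (vect R)) f z : open U -> U z ->
  (forall k z', U z' -> derivable f z' (basis_vect k)) ->
  (forall k, {for z, continuous ('D_(basis_vect k) f)}) ->
  exists m : 'I_3 -> vect R -> R,
    [/\ forall k, m k z = 'D_(basis_vect k) f z,
        forall k, {for z, continuous (m k)} &
        \forall z' \near z, f z' - f z = \sum_k m k z' * (z' 0 k - z 0 k)].
Proof.
move=> oU Uz df cf.
have [r r0 rU] : exists2 r : R, 0 < r & ball z r `<=` U.
  by have /nbhs_ballP[r r0 rU] := open_nbhs_nbhs (conj oU Uz); exists r.
(* A path from [z] to [z'] along the coordinate axes: [p z' l] has already received the first [l]
   coordinates of [z']. The increment of [f] telescopes along it. *)
pose p (z' : vect R) (l : nat) : vect R :=
  \row_k if (k < l)%N then z' 0 k else z 0 k.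
have pS z' (k : 'I_3) : p z' k.+1 = (z' 0 k - z 0 k) *: basis_vect k + p z' k.
  apply/rowP => l; rewrite !mxE eqxx /= ltnS leq_eqVlt.
  have -> : ((l : nat) == k) = (l == k) by [].
  case: eqVneq => [->|_]; first by rewrite ltnn mulr1 subrK.
  by rewrite mulr0 add0r.
(* A mean value point for the [k]-th edge of the path. The last two clauses make the chosen point
   continuous in [z'] at [z]: it stays in every ball around [z] that contains [z'], and it is [z]
   when [z' = z]. *)
have step (k : 'I_3) z' : exists xi : vect R, ball z r z' ->
    f (p z' k.+1) - f (p z' k) = 'D_(basis_vect k) f xi * (z' 0 k - z 0 k) /\
    (forall e, ball z e z' -> ball z e xi) /\ (z' = z -> xi = z).
  have [zz'|nz] := pselect (ball z r z'); last by exists 0.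
  pose v : vect R := (z' 0 k - z 0 k) *: basis_vect k.
  have inb e t : 0 <= t <= 1 -> ball z e z' -> ball z e (t *: v + p z' k).
    move=> /andP[t0 t1] zz'e; have e0 : 0 < e by case: zz'e.
    move/(ball_vectP _ _ e0) : zz'e => h; apply/(ball_vectP _ _ e0) => l.
    rewrite !mxE eqxx /=.
    case: eqVneq => [->|_].
      rewrite ltnn mulr1 opprD addrCA subrr addr0 normrN normrM distrC.
      by rewrite (le_lt_trans _ (h k))// ler_piMl// ger0_norm.
    rewrite mulr0 mulr0 add0r; case: ifP => _; first exact: h.
    by rewrite subrr normr0 (le_lt_trans _ (h l)).
  have dd t : 0 <= t <= 1 -> derivable f (t *: v + p z' k) (basis_vect k).
    by move=> t01; apply: df; apply: rU; apply: inb.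
  have dv t : 0 <= t <= 1 -> is_derive (t *: v + p z' k) v f
      ((z' 0 k - z 0 k) * 'D_(basis_vect k) f (t *: v + p z' k)).
    by move=> t01; apply: is_derive_scale; apply: dd.
  have [|t t01 E] := @MVT_line f (p z' k) v.
    by move=> t t01; case: (dv t t01).
  exists (t *: v + p z' k) => _; split; [|split].
  - by rewrite pS -[_ *: _]/v E; case: (dv t t01) => _ ->; rewrite mulrC.
  - by move=> e; exact: inb.
  - move=> zE; apply/rowP => l; rewrite !mxE zE subrr mul0r mulr0 add0r.
    by case: ifP.
pose xi k z' := sval (cid (step k z')).
have xiP k z' := svalP (cid (step k z')).
exists (fun k z' => 'D_(basis_vect k) f (xi k z')).
have xiz k : xi k z = z by have [|_ [_]] := xiP k z; [exact: ballxx|apply].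
split.
- by move=> k; rewrite xiz.
- move=> k; rewrite /prop_for /continuous_at /= xiz.
  suff xc : {for z, continuous (xi k)}.
    move: xc (cf k); rewrite /prop_for /continuous_at xiz => xc fc.
    exact: (cvg_comp _ _ xc fc).
  apply: continuous_vect => l; apply/continuous_dist => e e0; rewrite /= xiz.
  apply: filterS2 (near_ball z r0) (near_ball z e0) => z' zr ze.
  have [//|_ [h _]] := xiP k z'.
  by apply: (iffLR (ball_vectP _ _ e0)); apply: h.
- near=> z'.
  have zz' : ball z r z' by near: z'; exact: nbhsx_ballx.
  have -> : f z' - f z = f (p z' 3) - f (p z' 0%N).
    congr (f _ - f _); apply/rowP => l; rewrite mxE ?ltn0 //.
    by rewrite ltn_ord.
  rewrite -(@telescope_sumr _ 0 3 (fun l => f (p z' l)))// big_mkord.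
  by apply: eq_bigr => k _; have [] := xiP k z' zz'.
Unshelve. all: by end_near. Qed.

End Slopes.

(** * Functions of class C^n and the chain rule *)

Section Ck.
Variable R : realType.
Implicit Types (W U : set (vect R)) (f g : vect R -> R) (x v z : vect R).

(** Smoothness cut off at order [n]. The closure properties go by induction on [n], since the
    derivative of a product, inverse or composite involves the functions themselves at one order
    less. *)
Fixpoint Ck (n : nat) W f : Prop :=
  (forall z, W z -> {for z, continuous f}) /\
  if n is m.+1 then
    forall i : 'I_3, (forall z, W z -> derivable f z (basis_vect i)) /\
                     Ck m W ('D_(basis_vect i) f)
  else True.

Lemma Ck_cont n W f z : Ck n W f -> W z -> {for z, continuous f}.
Proof. by case: n => [|n] [h _]; exact: h. Qed.

Lemma Ck_derivable n W f z i :
  Ck n.+1 W f -> W z -> derivable f z (basis_vect i).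
Proof. by case=> _ h; apply: (h i).1. Qed.

Lemma Ck_partial n W f i : Ck n.+1 W f -> Ck n W ('D_(basis_vect i) f).
Proof. by case=> _ h; apply: (h i).2. Qed.

Lemma CkS n W f : Ck n.+1 W f -> Ck n W f.
Proof.
elim: n f => [|n IH] f [cf h]; split=> // i.
by split; [apply: (h i).1|apply: IH; apply: (h i).2].
Qed.

Lemma Ck_sub n W W' f : W' `<=` W -> Ck n W f -> Ck n W' f.
Proof.
move=> WW; elim: n f => [|n IH] f [cf h]; split=> //.
- by move=> z /WW; exact: cf.
- by move=> z /WW; exact: cf.
- by move=> i; split; [move=> z /WW; apply: (h i).1|apply: IH; apply: (h i).2].
Qed.

Lemma near_open (T : topologicalType) (A : set T) (P : T -> Prop) (x : T) :
  open A -> A x -> (forall y, A y -> P y) -> \near x, P x.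
Proof. by move=> oA Ax AP; apply: filterS AP _; exact: open_nbhs_nbhs. Qed.

Lemma continuous_near_eq (T : topologicalType) (p q : T -> R) (x : T) :
  (\near x, p x = q x) -> {for x, continuous p} -> {for x, continuous q}.
Proof.
move=> pq cp; rewrite /prop_for /continuous_at -(nbhs_singleton pq).
by apply: cvg_trans cp; exact: near_eq_cvg.
Qed.

Lemma Ck_eq n W f g : open W -> (forall z, W z -> f z = g z) ->
  Ck n W f -> Ck n W g.
Proof.
move=> oW; elim: n f g => [|n IH] f g fg [cf h]; split=> //.
- by move=> z Wz; apply: continuous_near_eq (cf z Wz); exact: near_open fg.
- by move=> z Wz; apply: continuous_near_eq (cf z Wz); exact: near_open fg.
- move=> i; split=> [z Wz|].
    by apply: near_eq_derivable ((h i).1 z Wz); exact: near_open fg.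
  by apply: IH (h i).2 => z Wz; apply: near_eq_derive; exact: near_open fg.
Qed.

Lemma smooth_onP W f : smooth_on W f <-> forall n, Ck n W f.
Proof.
split=> [sf n|sf s z Wz].
  suff: forall s, Ck n W (iter_partial s f) by move/(_ [::]).
  elim: n => [|n IH] s; split=> //.
  - by move=> z /(sf s)[].
  - by move=> z /(sf s)[].
  - move=> i; split; first by move=> z /(sf s)[_]; exact.
    exact: (IH (i :: s)).
have {}sf : forall n, Ck n W (iter_partial s f).
  by elim: s => [|i s IH] n //; exact: Ck_partial (IH n.+1).
split; first exact: Ck_cont (sf 0%N) Wz.
by move=> i; exact: Ck_derivable (sf 1%N) Wz.
Qed.

Lemma Ck1_slopes W f z : open W -> W z -> Ck 1 W f ->
  exists m : 'I_3 -> vect R -> R,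
    [/\ forall k, m k z = 'D_(basis_vect k) f z,
        forall k, {for z, continuous (m k)} &
        \forall z' \near z, f z' - f z = \sum_k m k z' * (z' 0 k - z 0 k)].
Proof.
move=> oW Wz cf; apply: (@C1_slopes _ W) => //.
- by move=> k z' Wz'; exact: Ck_derivable cf Wz'.
- by move=> k; exact: Ck_cont (Ck_partial k cf) Wz.
Qed.

(** The slopes of [f] at [G x], evaluated along [G (h *: v + x)] and divided by [h], express the
    difference quotient of the composite through those of the components of [G]; continuity of the
    slopes gives the limit. The source is an arbitrary normed module, so that curves and maps of R^3
    are both covered. *)
Lemma is_derive_comp_vect (V : normedModType R) W f (G : V -> vect R)
    (x v : V) (d : 'I_3 -> R) :
  open W -> W (G x) -> Ck 1 W f ->
  (forall k, is_derive x v (fun p => G p 0 k) (d k)) ->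
  is_derive x v (fun p => f (G p)) (\sum_k 'D_(basis_vect k) f (G x) * d k).
Proof.
move=> oW WGx cf dG.
have [m [mz mc mE]] := Ck1_slopes oW WGx cf.
have cG : G (h *: v + x) @[h --> (0 : R)^'] --> G x.
  apply: cvg_vect => k.
  have [/derivable1P/derivable1_diffP/differentiable_continuous c0 _] := dG k.
  apply: cvg_within_filter.
  by move: c0; rewrite /prop_for /continuous_at scale0r add0r.
have L : (fun h : R => h^-1 *: (((fun p => f (G p)) \o shift x) (h *: v) - f (G x)))
    @ 0^' --> \sum_k 'D_(basis_vect k) f (G x) * d k.
  have E : \forall h \near (0 : R)^', \sum_k m k (G (h *: v + x)) *
      (h^-1 *: (((fun p => G p 0 k) \o shift x) (h *: v) - G x 0 k)) =
      h^-1 *: (((fun p => f (G p)) \o shift x) (h *: v) - f (G x)).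
    have mE' : \forall h \near (0 : R)^', f (G (h *: v + x)) - f (G x) =
        \sum_k m k (G (h *: v + x)) * (G (h *: v + x) 0 k - G x 0 k).
      exact: cG _ mE.
    apply: filterS mE' => h /= ->.
    by rewrite scaler_sumr; apply: eq_bigr => k _; rewrite scalerAr.
  apply: (cvg_trans (near_eq_cvg E)).
  apply: cvg_big => [|k _]; first exact: add_continuous.
  apply: cvgM.
    rewrite -mz; exact: (cvg_comp _ _ cG (mc k)).
  by have [/cvgP dk <-] := dG k; exact: dk.
split; first exact: cvgP L.
exact: cvg_lim L.
Qed.

End Ck.

(** * Stability of the class C^n under algebraic operations and composition *)

Section SmoothOps.
Variable R : realType.
Implicit Types (W U : set (vect R)) (f g : vect R -> R) (x v z : vect R).
Implicit Types (G : vect R -> vect R).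

Lemma Ck_cst n W (c : R) : Ck n W (fun=> c).
Proof.
elim: n c => [|n IH] c; split=> //; do ?by move=> z _; exact: cst_continuous.
move=> i; split=> [z _|]; first exact: derivable_cst.
have -> : 'D_(basis_vect i) (fun=> c) = (fun=> 0) :> (vect R -> R).
  by apply/funext => z; exact: derive_cst.
exact: IH.
Qed.

Lemma is_derive_coord z v (k : 'I_3) :
  is_derive z v (fun y : vect R => y 0 k) (v 0 k).
Proof.
have L : (fun h : R => h^-1 *: (((fun y : vect R => y 0 k) \o shift z) (h *: v) - z 0 k))
    @ 0^' --> v 0 k.
  apply: cvg_near_cst; near=> h.
  rewrite /= !mxE addrK [LHS]mulrA mulVf ?mul1r//.
  by near: h; exact: nbhs_dnbhs_neq.
split; first exact: cvgP L.
exact: cvg_lim L.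
Unshelve. all: by end_near. Qed.

Lemma Ck_coord n W k : Ck n W (fun z => z 0 k).
Proof.
case: n => [|n]; split=> //; do ?by move=> z _; exact: coord_continuous.
move=> i; split=> [z _|]; first by case: (is_derive_coord z (basis_vect i) k).
have -> : 'D_(basis_vect i) (fun y : vect R => y 0 k) = (fun=> (basis_vect i : vect R) 0 k).
  by apply/funext => z; case: (is_derive_coord z (basis_vect i) k).
exact: Ck_cst.
Qed.

Lemma CkD n W f g : open W -> Ck n W f -> Ck n W g ->
  Ck n W (fun z => f z + g z).
Proof.
move=> oW; elim: n f g => [|n IH] f g hf hg; split=> //.
- by move=> z Wz; exact: continuousD (Ck_cont hf Wz) (Ck_cont hg Wz).
- by move=> z Wz; exact: continuousD (Ck_cont hf Wz) (Ck_cont hg Wz).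
- move=> i; split=> [z Wz|].
    exact: (@derivableD _ _ _ f g) (Ck_derivable hf Wz) (Ck_derivable hg Wz).
  apply: Ck_eq oW _ (IH _ _ (Ck_partial i hf) (Ck_partial i hg)) => z Wz.
  rewrite -[RHS]/('D_(basis_vect i) (f + g) z) deriveD//;
    [exact: Ck_derivable hf Wz|exact: Ck_derivable hg Wz].
Qed.

Lemma CkM n W f g : open W -> Ck n W f -> Ck n W g ->
  Ck n W (fun z => f z * g z).
Proof.
move=> oW; elim: n f g => [|n IH] f g hf hg; split=> //.
- by move=> z Wz; exact: continuousM (Ck_cont hf Wz) (Ck_cont hg Wz).
- by move=> z Wz; exact: continuousM (Ck_cont hf Wz) (Ck_cont hg Wz).
- move=> i; split=> [z Wz|].
    exact: (@derivableM _ _ f g) (Ck_derivable hf Wz) (Ck_derivable hg Wz).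
  have h1 := IH _ _ (CkS hf) (Ck_partial i hg).
  have h2 := IH _ _ (CkS hg) (Ck_partial i hf).
  apply: Ck_eq oW _ (CkD oW h1 h2) => z Wz.
  rewrite -[RHS]/('D_(basis_vect i) (f * g) z) deriveM//;
    [exact: Ck_derivable hf Wz|exact: Ck_derivable hg Wz].
Qed.

Lemma Ck_sum n W (I : Type) (r : seq I) (F : I -> vect R -> R) : open W ->
  (forall k, Ck n W (F k)) -> Ck n W (fun z => \sum_(k <- r) F k z).
Proof.
move=> oW hF; elim: r => [|k r IH].
  by apply: Ck_eq oW _ (Ck_cst n W 0) => z _; rewrite big_nil.
by apply: Ck_eq oW _ (CkD oW (hF k) IH) => z _; rewrite big_cons.
Qed.

Lemma CkV n W f : open W -> (forall z, W z -> f z != 0) -> Ck n W f ->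
  Ck n W (fun z => (f z)^-1).
Proof.
move=> oW f0; elim: n => [|n IH] hf; split=> //.
- by move=> z Wz; apply: continuousV; [exact: f0|exact: Ck_cont hf Wz].
- by move=> z Wz; apply: continuousV; [exact: f0|exact: Ck_cont hf Wz].
- move=> i; split=> [z Wz|].
    by apply: (@derivableV _ _ f); [exact: f0|exact: Ck_derivable hf Wz].
  have hV := IH (CkS hf).
  have h := CkM oW (Ck_cst n W (-1)) (CkM oW (CkM oW hV hV) (Ck_partial i hf)).
  apply: Ck_eq oW _ h => z Wz.
  rewrite -[RHS]/('D_(basis_vect i) (fun z => (f z)^-1) z) deriveV//.
  - transitivity (- (f z) ^- 2 * 'D_(basis_vect i) f z); last by [].
    by rewrite -exprVn expr2 mulN1r mulNr.
  - exact: f0.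
  - exact: Ck_derivable hf Wz.
Qed.

Lemma continuous_comp_vect W W' f G z : W' z -> (forall z, W' z -> W (G z)) ->
  (forall k, {for z, continuous (fun z => G z 0 k)}) ->
  (forall z, W z -> {for z, continuous f}) ->
  {for z, continuous (fun z => f (G z))}.
Proof.
move=> W'z GW cG cf.
have c1 : {for z, continuous G} by exact: continuous_vect.
exact: continuous_comp c1 (cf _ (GW _ W'z)).
Qed.

Lemma Ck_comp n W W' f G : open W -> open W' -> (forall z, W' z -> W (G z)) ->
  (forall k, Ck n W' (fun z => G z 0 k)) -> Ck n W f ->
  Ck n W' (fun z => f (G z)).
Proof.
move=> oW oW' GW; elim: n f => [|n IH] f hG hf; split=> //.
- move=> z W'z; apply: (continuous_comp_vect W'z GW) => [k|y].
    exact: Ck_cont (hG k) W'z.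
  exact: Ck_cont hf.
- move=> z W'z; apply: (continuous_comp_vect W'z GW) => [k|y].
    exact: Ck_cont (hG k) W'z.
  exact: Ck_cont hf.
have h1 : Ck 1 W f.
  by elim: (n) hf => // m IHm /CkS.
move=> i.
have dc z : W' z -> is_derive z (basis_vect i) (fun z => f (G z))
    (\sum_k 'D_(basis_vect k) f (G z) *
       'D_(basis_vect i) (fun z => G z 0 k) z).
  move=> W'z; apply: is_derive_comp_vect oW (GW _ W'z) h1 _ => k.
  exact: derivableP (Ck_derivable (hG k) W'z).
split=> [z W'z|]; first by case: (dc z W'z).
have h k : Ck n W' (fun z => 'D_(basis_vect k) f (G z) *
    'D_(basis_vect i) (fun z => G z 0 k) z).
  apply: CkM => //; last exact: Ck_partial (hG k).
  by apply: IH (Ck_partial k hf) => // l; exact: CkS (hG l).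
have hs : Ck n W' (fun z => \sum_k 'D_(basis_vect k) f (G z) *
    'D_(basis_vect i) (fun z => G z 0 k) z).
  exact: Ck_sum.
by apply: Ck_eq oW' _ hs => z W'z; case: (dc z W'z).
Qed.

End SmoothOps.

(** * Smooth functions *)

Section Smooth.
Variable R : realType.
Implicit Types (W U : set (vect R)) (f g : vect R -> R) (x v z : vect R).
Implicit Types (G : vect R -> vect R) (a b : R).

Lemma is_derive_add (V : normedModType R) (x v : V) (f g : V -> R) a b :
  is_derive x v f a -> is_derive x v g b ->
  is_derive x v (fun q => f q + g q) (a + b).
Proof. by move=> df dg; exact: (@is_deriveD _ _ _ f g). Qed.

Lemma is_derive_mul (V : normedModType R) (x v : V) (f g : V -> R) a b :
  is_derive x v f a -> is_derive x v g b ->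
  is_derive x v (fun q => f q * g q) (a * g x + f x * b).
Proof.
move=> df dg; apply: is_derive_eq (@is_deriveM _ _ f g x v a b df dg) _.
by rewrite [LHS]/(_ * _ + _ * _) addrC (mulrC a).
Qed.

Lemma is_derive_inv (V : normedModType R) (x v : V) (f : V -> R) a :
  f x != 0 -> is_derive x v f a ->
  is_derive x v (fun q => (f q)^-1) (- a / f x ^+ 2).
Proof.
move=> f0 [df <-]; split; first exact: derivableV.
transitivity (- (f x) ^- 2 * 'D_v f x); first exact: deriveV.
by rewrite !mulNr mulrC.
Qed.

Lemma is_derive_bigsum (V : normedModType R) (x v : V) (F : 'I_3 -> V -> R)
    (d : 'I_3 -> R) :
  (forall k, is_derive x v (F k) (d k)) ->
  is_derive x v (fun q => \sum_k F k q) (\sum_k d k).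
Proof.
move=> dF; have := is_derive_sum dF.
suff -> : (\sum_k F k) = (fun q => \sum_k F k q) by [].
by apply/funext => y; rewrite fct_sumE.
Qed.

Lemma smooth_derivable W f z i : smooth_on W f -> W z ->
  is_derive z (basis_vect i) f ('D_(basis_vect i) f z).
Proof.
move=> /smooth_onP/(_ 1%N) h Wz; exact: derivableP (Ck_derivable h Wz).
Qed.

Lemma smooth_continuous W f z : smooth_on W f -> W z -> {for z, continuous f}.
Proof. by move=> /smooth_onP/(_ 0%N) h; exact: Ck_cont h. Qed.

Lemma smooth_partial W f i : smooth_on W f -> smooth_on W ('D_(basis_vect i) f).
Proof.
move=> /smooth_onP h; apply/smooth_onP => n; exact: Ck_partial (h n.+1).
Qed.

Lemma smooth_sub W W' f : W' `<=` W -> smooth_on W f -> smooth_on W' f.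
Proof.
move=> WW /smooth_onP h; apply/smooth_onP => n; exact: Ck_sub (h n).
Qed.

Lemma smooth_eq W f g : open W -> (forall z, W z -> f z = g z) ->
  smooth_on W f -> smooth_on W g.
Proof.
move=> oW fg /smooth_onP h; apply/smooth_onP => n; exact: Ck_eq (h n).
Qed.

Lemma smooth_cst W a : smooth_on W (fun=> a).
Proof. by apply/smooth_onP => n; exact: Ck_cst. Qed.

Lemma smooth_coord W (k : 'I_3) : smooth_on W (fun z => z 0 k).
Proof. by apply/smooth_onP => n; exact: Ck_coord. Qed.

Lemma smooth_add W f g : open W -> smooth_on W f -> smooth_on W g ->
  smooth_on W (fun z => f z + g z).
Proof.
by move=> oW /smooth_onP hf /smooth_onP hg; apply/smooth_onP => n; exact: CkD.
Qed.

Lemma smooth_mul W f g : open W -> smooth_on W f -> smooth_on W g ->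
  smooth_on W (fun z => f z * g z).
Proof.
by move=> oW /smooth_onP hf /smooth_onP hg; apply/smooth_onP => n; exact: CkM.
Qed.

Lemma smooth_inv W f : open W -> (forall z, W z -> f z != 0) ->
  smooth_on W f -> smooth_on W (fun z => (f z)^-1).
Proof.
by move=> oW f0 /smooth_onP hf; apply/smooth_onP => n; exact: CkV.
Qed.

Lemma smooth_comp W W' f G : open W -> open W' ->
  (forall z, W' z -> W (G z)) -> smooth_map_on W' G -> smooth_on W f ->
  smooth_on W' (fun z => f (G z)).
Proof.
move=> oW oW' GW sG /smooth_onP hf; apply/smooth_onP => n.
by apply: Ck_comp (hf n) => // k; exact: (iffLR (smooth_onP _ _) (sG k) n).
Qed.

Lemma is_derive_comp_smooth (V : normedModType R) W f (G : V -> vect R)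
    (z v : V) (d : 'I_3 -> R) :
  open W -> W (G z) -> smooth_on W f ->
  (forall k, is_derive z v (fun p => G p 0 k) (d k)) ->
  is_derive z v (fun p => f (G p)) (\sum_k 'D_(basis_vect k) f (G z) * d k).
Proof.
by move=> oW Wz /smooth_onP h; exact: is_derive_comp_vect oW Wz (h 1%N).
Qed.

Lemma is_derive_smooth W f z v : open W -> W z -> smooth_on W f ->
  is_derive z v f (\sum_k 'D_(basis_vect k) f z * v 0 k).
Proof.
move=> oW Wz sf; apply: (@is_derive_comp_smooth _ W f id) => // k.
exact: is_derive_coord.
Qed.

Lemma smooth_map_continuous W G z : smooth_map_on W G -> W z ->
  {for z, continuous G}.
Proof.
by move=> sG Wz; apply: continuous_vect => k; exact: smooth_continuous (sG k) Wz.
Qed.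

Lemma open_preimage (T : topologicalType) (A : set (vect R)) (B : set T)
    (g : vect R -> T) : open A -> open B ->
  (forall z, A z -> {for z, continuous g}) -> open (A `&` g @^-1` B).
Proof.
move=> oA oB cg; rewrite openE => z [Az Bz].
apply: filterI; first exact: open_nbhs_nbhs.
exact: (cg z Az _ (open_nbhs_nbhs (conj oB Bz))).
Qed.

(** The mean value theorem is applied in direction [i] to [f (s *: e_j + y) - f y], then in
    direction [j] to the [i]-th partial derivative. The radius [s *+ 3] is strictly larger than the
    largest displacement of a coordinate, which is [2 s] and occurs when [i = j]. *)
Lemma second_difference W f z i j (s : R) : open W -> smooth_on W f -> 0 < s ->
  ball z (s *+ 3) `<=` W ->
  exists2 xi, ball z (s *+ 3) xi &
    f (s *: basis_vect i + (s *: basis_vect j + z)) -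
    f (s *: basis_vect j + z) - (f (s *: basis_vect i + z) - f z) =
    s * s * 'D_(basis_vect j) ('D_(basis_vect i) f) xi.
Proof.
move=> oW sf s0 bW.
have s30 : 0 < s *+ 3 by rewrite pmulrn_lgt0.
set ei : vect R := basis_vect i; set ej : vect R := basis_vect j.
have inb (t t' : R) : 0 <= t <= 1 -> 0 <= t' <= 1 ->
    ball z (s *+ 3) (t *: (s *: ei) + (t' *: (s *: ej) + z)).
  move=> t01 t'01; apply/(ball_vectP _ _ s30) => k; rewrite !mxE !eqxx /=.
  have b01 (b : bool) : 0 <= (b%:R : R) <= 1 by case: b; rewrite ?lexx ?ler01.
  move: (b01 (k == i)) (b01 (k == j)).
  set A := _%:R; set B := _%:R => hA hB.
  have hh u C : 0 <= u <= 1 -> 0 <= C <= 1 -> 0 <= u * (s * C) <= s.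
    move=> /andP[u0 u1] /andP[C0 C1].
    rewrite !mulr_ge0 ?(ltW s0)//= mulrC -mulrA ler_piMr ?(ltW s0)//.
    by rewrite mulr_ile1.
  have := hh t A t01 hA; have := hh t' B t'01 hB.
  rewrite ltr_norml; lra.
pose phi y := f (s *: ej + y) - f y.
have dphi (t : R) : 0 <= t <= 1 -> is_derive (t *: (s *: ei) + z) (s *: ei) phi
   (s * ('D_ei f (s *: ej + (t *: (s *: ei) + z)) - 'D_ei f (t *: (s *: ei) + z))).
  move=> t01.
  have W1 : W (s *: ej + (t *: (s *: ei) + z)).
    apply: bW; have := inb t 1 t01; rewrite scale1r addrCA; apply.
    by rewrite ler01 lexx.
  have W2 : W (t *: (s *: ei) + z).
    apply: bW; have := inb t 0 t01; rewrite scale0r add0r; apply.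
    by rewrite ler01 lexx.
  have d2 := is_derive_scale s (@ex_derive _ _ _ _ _ _ _ (smooth_derivable i sf W2)).
  have d1 := is_derive_scale s (@ex_derive _ _ _ _ _ _ _ (smooth_derivable i sf W1)).
  rewrite mulrBr; apply: (@is_deriveB _ _ _ (fun y => f (s *: ej + y)) f).
  have E : (fun h : R => h^-1 *:
      (((fun y => f (s *: ej + y)) \o shift (t *: (s *: ei) + z)) (h *: (s *: ei)) -
       f (s *: ej + (t *: (s *: ei) + z)))) =
    (fun h => h^-1 *:
      ((f \o shift (s *: ej + (t *: (s *: ei) + z))) (h *: (s *: ei)) -
       f (s *: ej + (t *: (s *: ei) + z)))).
    by apply/funext => h /=; rewrite addrCA.
  by case: d1 => d1 d1'; split; [rewrite /derivable E|rewrite -d1' /derive E].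
have [|t t01 Et] := @MVT_line _ phi z (s *: ei).
  by move=> t t01; case: (dphi t t01).
have dD (t' : R) : 0 <= t' <= 1 ->
    is_derive (t' *: (s *: ej) + (t *: (s *: ei) + z)) (s *: ej) ('D_ei f)
    (s * 'D_ej ('D_ei f) (t' *: (s *: ej) + (t *: (s *: ei) + z))).
  move=> t'01; apply: is_derive_scale.
  have W1 : W (t' *: (s *: ej) + (t *: (s *: ei) + z)).
    by apply: bW; rewrite addrCA; exact: inb.
  by case: (smooth_derivable j (smooth_partial i sf) W1).
have [|t' t'01 Et'] := @MVT_line _ ('D_ei f) (t *: (s *: ei) + z) (s *: ej).
  by move=> t' t'01; case: (dD t' t'01).
exists (t' *: (s *: ej) + (t *: (s *: ei) + z)).
  by rewrite addrCA; exact: inb.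
transitivity (phi (s *: ei + z) - phi z).
  by rewrite /phi (addrCA (s *: ej)); ring.
rewrite Et; case: (dphi t t01) => _ ->; rewrite Et'.
by case: (dD t' t'01) => _ ->; rewrite mulrA.
Qed.

Let cancel (a b c d p q t : R) : t != 0 -> a - b - (c - d) = t * p ->
  a - c - (b - d) = t * q -> p = q.
Proof. by move=> t0 Ep Eq; apply: (mulfI t0); rewrite -Ep -Eq; ring. Qed.

Let close (e p q t u : R) : `|p - t| < e / 2 -> `|q - u| < e / 2 -> t = u ->
  `|p - q| <= e.
Proof.
by move=> pt qu tu; rewrite ler_norml; move: pt qu; rewrite tu !ltr_norml; lra.
Qed.

(** The second difference is symmetric in [i] and [j], so after division by [s * s] both mixed
    derivatives take the same value, at two points close to [z]; their continuity makes them equal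
    at [z]. *)
Lemma partialC W f z i j : open W -> smooth_on W f -> W z ->
  'D_(basis_vect j) ('D_(basis_vect i) f) z =
  'D_(basis_vect i) ('D_(basis_vect j) f) z.
Proof.
move=> oW sf Wz; apply/eqP; rewrite -subr_eq0 -normr_le0; apply/ler_addgt0Pl => e e0.
rewrite addr0.
have c1 := smooth_continuous (smooth_partial j (smooth_partial i sf)) Wz.
have c2 := smooth_continuous (smooth_partial i (smooth_partial j sf)) Wz.
have e2 : 0 < e / 2 by rewrite divr_gt0.
have N1 := (iffLR (continuous_dist _ _) c1) _ e2.
have N2 := (iffLR (continuous_dist _ _) c2) _ e2.
have N3 : \near z, W z by exact: open_nbhs_nbhs.
have N := @filterI _ _ (nbhs_filter z) _ _ N3 (@filterI _ _ (nbhs_filter z) _ _ N1 N2).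
have [r /= r0 rP] := iffLR (nbhs_ballP _ _) N.
have s0 : 0 < r / 3 by rewrite divr_gt0.
have sr : (r / 3) *+ 3 = r by rewrite -mulr_natr divfK.
have [|xi bxi E1] := @second_difference W f z i j _ oW sf s0.
  by rewrite sr => y /rP[].
have [|xi' bxi' E2] := @second_difference W f z j i _ oW sf s0.
  by rewrite sr => y /rP[].
rewrite sr in bxi bxi'.
have [_ [/= h1 _]] := rP _ bxi; have [_ [/= _ h2]] := rP _ bxi'.
have s20 : r / 3 * (r / 3) != 0 by rewrite mulf_neq0 // gt_eqF.
apply: close h1 h2 _.
rewrite (addrCA (r / 3 *: basis_vect j)) in E2.
exact: cancel s20 E1 E2.
Qed.

End Smooth.

(** * Replacing one coordinate by a function *)

Section Straighten.
Variable R : realType.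
Implicit Types (W U V : set (vect R)) (f g : vect R -> R) (x v z u : vect R).
Implicit Types (G : vect R -> vect R) (a b : R).

Definition diffeo V U (x y : vect R -> vect R) :=
  [/\ open V, open U, smooth_map_on V x, smooth_map_on U y &
      (forall z, V z -> U (x z) /\ y (x z) = z) /\
      (forall u, U u -> V (y u) /\ x (y u) = u)].

Definition set_coord (i : 'I_3) z a : vect R :=
  \row_k if k == i then a else z 0 k.

Lemma set_coordE i z a : set_coord i z a = (a - z 0 i) *: basis_vect i + z.
Proof.
apply/rowP => k; rewrite !mxE eqxx /=.
by case: eqVneq => [->|_]; rewrite ?mulr1 ?subrK// mulr0 add0r.
Qed.

Lemma set_coord_id i z a : set_coord i (set_coord i z a) (z 0 i) = z.
Proof. by apply/rowP => k; rewrite !mxE; case: eqVneq => [->|]. Qed.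

(** Convexity of an interval: [a - t b] is the combination [(1 - t) a + t (a - b)]. *)
Let interp (r a b t : R) : 0 <= t <= 1 -> `|a| < r -> `|a - b| < r ->
  `|a - t * b| < r.
Proof.
rewrite !ltr_norml => /andP[t0 t1] /andP[a1 a2] /andP[b1 b2].
have [t01|t01] := ltP t 1; last by have -> : t = 1 by [lra]; apply/andP; split; lra.
have : 0 < (1 - t) * (r - a) by apply: mulr_gt0; lra.
have : 0 <= t * (r - (a - b)) by apply: mulr_ge0; lra.
have : 0 < (1 - t) * (r + a) by apply: mulr_gt0; lra.
have : 0 <= t * (r + (a - b)) by apply: mulr_ge0; lra.
by move=> *; apply/andP; split; lra.
Qed.

Lemma ball_segment z v x (r t : R) : 0 <= t <= 1 ->
  ball z r x -> ball z r (v + x) -> ball z r (t *: v + x).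
Proof.
move=> t01 bx; have r0 : 0 < r by case: bx.
move: bx => /(ball_vectP _ _ r0) bx /(ball_vectP _ _ r0) bvx.
apply/(ball_vectP _ _ r0) => k; move: (bx k) (bvx k); rewrite !mxE => h1 h2.
have -> : z 0 k - (t * v 0 k + x 0 k) = (z 0 k - x 0 k) - t * v 0 k by ring.
apply: interp => //.
by have -> : z 0 k - x 0 k - v 0 k = z 0 k - (v 0 k + x 0 k) by ring.
Qed.

Lemma MVT_coord (z0 : vect R) r f i z a :
  smooth_on (ball z0 r) f -> ball z0 r z -> ball z0 r (set_coord i z a) ->
  exists2 xi, ball z0 r xi &
    f (set_coord i z a) - f z = (a - z 0 i) * 'D_(basis_vect i) f xi.
Proof.
rewrite set_coordE; set v : vect R := _ *: _ => sf bz bvz.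
have dv t : 0 <= t <= 1 -> is_derive (t *: v + z) v f
    ((a - z 0 i) * 'D_(basis_vect i) f (t *: v + z)).
  move=> t01; apply: is_derive_scale.
  by case: (smooth_derivable i sf (ball_segment t01 bz bvz)).
have [|t t01 E] := @MVT_line _ f z v.
  by move=> t t01; case: (dv t t01).
exists (t *: v + z); first exact: ball_segment.
by rewrite E; case: (dv t t01).
Qed.

Lemma continuous_gt0 (T : topologicalType) (q : T -> R) (x : T) :
  {for x, continuous q} -> 0 < q x -> \forall y \near x, 0 < q y.
Proof.
move=> /continuous_dist cq q0; move: (cq _ q0); apply: filterS => y.
by rewrite ltr_norml => /andP[_]; lra.
Qed.

Lemma continuous_set_coord i (T : topologicalType) (q : T -> vect R)
    (a : T -> R) (x : T) : {for x, continuous q} -> {for x, continuous a} ->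
  {for x, continuous (fun y => set_coord i (q y) (a y))}.
Proof.
move=> cq ca; apply: continuous_vect => k; case: (eqVneq k i) => [ki|ki].
  by rewrite (_ : (fun p => _) = a)//; apply/funext => y; rewrite mxE ki eqxx.
rewrite (_ : (fun p => _) = (fun y => q y 0 k)).
  apply: (@continuous_comp _ _ _ q (fun z : vect R => z 0 k)) => //.
  exact: coord_continuous.
by apply/funext => y; rewrite mxE (negbTE ki).
Qed.

(** * Inverting the replacement of one coordinate on a ball *)

Section Inverse.
Variables (p : vect R) (r : R) (f : vect R -> R) (i : 'I_3).
Hypothesis r0 : 0 < r.
Hypothesis sf : smooth_on (ball p r) f.
(** Multiplying by the derivative at the centre fixes the sign: [c * f] increases with the [i]-th
    coordinate whether [f] increases or decreases. *)
Let c : R := 'D_(basis_vect i) f p.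
Hypothesis df : forall z, ball p r z -> 0 < c * 'D_(basis_vect i) f z.
Let Phi z := set_coord i z (f z).

Let mono z a : ball p r z -> ball p r (set_coord i z a) -> z 0 i < a ->
  c * f z < c * f (set_coord i z a).
Proof.
move=> bz bz' za; have [xi bxi E] := MVT_coord sf bz bz'.
rewrite -subr_gt0 -mulrBr E mulrCA mulr_gt0// ?subr_gt0//.
exact: df.
Qed.

Let inj z z' : ball p r z -> ball p r z' -> Phi z = Phi z' -> z = z'.
Proof.
move=> bz bz' E.
have Ek k : k != i -> z 0 k = z' 0 k.
  by move=> ki; move/rowP/(_ k): E; rewrite !mxE (negbTE ki).
have Ef : f z = f z' by move/rowP/(_ i): E; rewrite !mxE eqxx.
have zz' : z' = set_coord i z (z' 0 i).
  by apply/rowP => k; rewrite mxE; case: eqVneq => [->//|/Ek].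
have z'z : z = set_coord i z' (z 0 i).
  by apply/rowP => k; rewrite mxE; case: eqVneq => [->//|/Ek ->].
have [h|h|h] := ltgtP (z 0 i) (z' 0 i).
- have := @mono z (z' 0 i) bz; rewrite -zz' => /(_ bz' h).
  by rewrite Ef ltxx.
- have := @mono z' (z 0 i) bz'; rewrite -z'z => /(_ bz h).
  by rewrite Ef ltxx.
- by rewrite zz' -h; apply/rowP => k; rewrite mxE; case: eqVneq => [->|].
Qed.

Let ball_open_vect : open (ball p r).
Proof. exact: ball_open. Qed.

(** Intermediate value theorem on the segment [z_i - d/2, z_i + d/2]: at its ends [c * f] lies
    strictly below and above the target, and this persists for [u] near [Phi z]. Since the preimage
    is found within [e] of [z], the same statement yields that the image is open and that the
    inverse is continuous. *)
Let surj z (e : R) : ball p r z -> 0 < e -> \forall u \near Phi z,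
  exists z', [/\ ball p r z', ball z e z' & Phi z' = u].
Proof.
move=> bz e0.
have [d d0 dP] : exists2 d : R, 0 < d & ball z d `<=` ball p r `&` ball z e.
  have N : nbhs z (ball p r `&` ball z e).
    have Na : nbhs z (ball p r) by exact: open_nbhs_nbhs.
    have Nb : nbhs z (ball z e) by exact: nbhsx_ballx.
    exact: (@filterI _ _ (nbhs_filter z) _ _ Na Nb).
  by have [d d0 dP] := iffLR (nbhs_ballP _ _) N; exists d.
have d20 : 0 < d / 2 by rewrite divr_gt0.
have dd : d / 2 < d by rewrite ltr_pdivrMr// ltr_pMr// ltr1n.
pose zp s := set_coord i z (z 0 i + s).
have bzp s : `|s| < d -> ball z d (zp s).
  move=> sd; apply/(ball_vectP _ _ d0) => k; rewrite mxE.
  case: eqVneq => [->|_]; last by rewrite subrr normr0.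
  by rewrite opprD addrA subrr add0r normrN.
(* The gap at height [z_i + s] between [c * f] and its target [c * u_i]. The [i]-th coordinate of
   [u] enters only as the target; the others fix the vertical line that is searched. *)
pose q (s : R) (u : vect R) : R := c * f (set_coord i u (z 0 i + s)) - c * u 0 i.
have qPhi s : q s (Phi z) = c * f (zp s) - c * f z.
  rewrite /q mxE eqxx; congr (c * f _ - _).
  by apply/rowP => k; rewrite !mxE; case: eqVneq.
have cq s : `|s| < d -> {for Phi z, continuous (q s)}.
  move=> sd; apply: continuousB; apply: continuousM; try exact: cst_continuous.
    have E : set_coord i (Phi z) (z 0 i + s) = zp s.
      by apply/rowP => k; rewrite !mxE; case: eqVneq.
    apply: (@continuous_comp _ _ _ (fun u => set_coord i u (z 0 i + s)) f).
      by apply: continuous_set_coord; [exact: cvg_id|exact: cst_continuous].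
    by rewrite E; apply: smooth_continuous sf _; have [] := dP _ (bzp _ sd).
  exact: coord_continuous.
have bz0 : ball p r z by [].
have N1 : \forall u \near Phi z, 0 < q (d / 2) u.
  have sd : `|d / 2| < d by rewrite gtr0_norm.
  apply: continuous_gt0; first exact: cq.
  rewrite qPhi subr_gt0; apply: mono => //; last by rewrite ltrDl.
  by have [] := dP _ (bzp _ sd).
have N2 : \forall u \near Phi z, 0 < - q (- (d / 2)) u.
  have sd : `|- (d / 2)| < d by rewrite normrN gtr0_norm.
  apply: (@continuous_gt0 _ (fun u => - q (- (d / 2)) u)).
    by apply: continuousN; exact: cq.
  rewrite qPhi oppr_gt0 subr_lt0 -[X in _ < c * f X](set_coord_id i z (z 0 i - d / 2)).
  have [bp _] := dP _ (bzp _ sd).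
  apply: mono => //; first by rewrite set_coord_id.
  by rewrite mxE eqxx ltrBlDr ltrDl.
have N3 : nbhs (Phi z) (ball (Phi z) d) by exact: nbhsx_ballx.
apply: filterS (@filterI _ _ (nbhs_filter _) _ _ N3
  (@filterI _ _ (nbhs_filter _) _ _ N1 N2)) => u [/(ball_vectP _ _ d0) bu [q1 q2]].
have bt t : t \in `[z 0 i - d / 2, z 0 i + d / 2] -> ball z d (set_coord i u t).
  rewrite in_itv /= => /andP[t1 t2]; apply/(ball_vectP _ _ d0) => k.
  rewrite mxE; case: eqVneq => [->|ki].
    by rewrite ltr_norml; move: t1 t2 dd d20; set y := z 0 i; lra.
  by have := bu k; rewrite mxE (negbTE ki).
have [| | |t tI Et] := @IVT R (fun t : R => c * f (set_coord i u t) : R)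
    (z 0 i - d / 2) (z 0 i + d / 2) (c * u 0 i).
- by move: d20; set y := z 0 i; lra.
- apply: continuous_in_subspaceT => t; rewrite inE => tI.
  apply: (@continuousM _ _ (fun=> c) (fun t => f (set_coord i u t))).
    exact: cst_continuous.
  apply: (@continuous_comp _ _ _ (fun t => set_coord i u t) f).
    by apply: continuous_set_coord; [exact: cst_continuous|exact: cvg_id].
  by apply: smooth_continuous sf _; have [] := dP _ (bt _ tI).
- move: q1 q2; rewrite /q oppr_gt0 subr_lt0 subr_gt0 => /ltW q1 /ltW q2.
  by rewrite ge_min q2 le_max q1 orbT.
have c0 : c != 0.
  by apply: contraTneq (df bz) => ->; rewrite mul0r ltxx.
have [b1 b2] := dP _ (bt _ tI).
exists (set_coord i u t); split=> //.
rewrite /Phi (mulfI c0 Et); apply/rowP => k; rewrite !mxE.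
by case: eqVneq => [->|].
Qed.

Let U := [set u | exists2 z, ball p r z & Phi z = u].

Let psi u : vect R := if pselect (U u) is left h then s2val (cid2 h) else 0.

Let psiK u : U u -> ball p r (psi u) /\ Phi (psi u) = u.
Proof. by rewrite /psi; case: pselect => // h _; case: cid2. Qed.

Let PhiK z : ball p r z -> psi (Phi z) = z.
Proof.
move=> bz; have [|b E] := @psiK (Phi z); first by exists z.
exact: inj.
Qed.

Let U_open : open U.
Proof.
rewrite openE => u [z bz <-]; move: (surj bz r0); apply: filterS => y [z' [bz' _ E]].
by exists z'.
Qed.

Let psi_continuous u : U u -> {for u, continuous psi}.
Proof.
move=> Uu; have [b E] := psiK Uu.
apply: continuous_vect => k; apply/continuous_dist => e e0.
have S := surj b e0; rewrite E in S.
apply: (@filterS _ _ (nbhs_filter u) _ _ _ S) => y [z' [bz' be <-]].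
by rewrite PhiK//; move/(ball_vectP _ _ e0): be.
Qed.

(** What implicit differentiation of [f (psi u) = u_i] gives for the [i]-th component, the other
    components of [psi u] being those of [u]. *)
Let dpsi (j : 'I_3) u : R :=
  ((j == i)%:R - (j != i)%:R * 'D_(basis_vect j) f (psi u)) *
  ('D_(basis_vect i) f (psi u))^-1.

Let psi_coord u k : U u -> k != i -> psi u 0 k = u 0 k.
Proof.
by move=> /psiK[_ /rowP/(_ k)]; rewrite mxE => + /negbTE ki; rewrite ki.
Qed.

Let f_psi u : U u -> f (psi u) = u 0 i.
Proof. by move=> /psiK[_ /rowP/(_ i)]; rewrite mxE eqxx. Qed.

(** The slopes of [f] at [psi u] turn [f (psi u) = u_i] into a linear equation for the increment of
    the [i]-th component of [psi]. Solving it gives the difference quotient exactly, and continuity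
    of [psi] lets the slopes converge. *)
Let is_derive_psi u j : U u ->
  is_derive u (basis_vect j) (fun u => psi u 0 i) (dpsi j u).
Proof.
move=> Uu; have [b E] := psiK Uu.
have [m [mz mc mE]] := Ck1_slopes ball_open_vect b (iffLR (smooth_onP _ _) sf 1%N).
have c0 : m i (psi u) != 0.
  rewrite mz; apply: contraTneq (df b) => ->; by rewrite mulr0 ltxx.
have cu : (h *: basis_vect j + u) @[h --> (0 : R)^'] --> u.
  apply: cvg_vect => k; apply: cvg_within_filter.
  rewrite (_ : (fun p => _) = (fun h : R => h * (basis_vect j : vect R) 0 k + u 0 k)); last first.
    by apply/funext => h; rewrite !mxE.
  have : (fun h : R => h * (basis_vect j : vect R) 0 k + u 0 k) @ (0 : R) -->
      0 * (basis_vect j : vect R) 0 k + u 0 k.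
    by apply: cvgD; [apply: cvgM; [exact: cvg_id|exact: cvg_cst]|exact: cvg_cst].
  by rewrite mul0r add0r.
have cpsi : psi (h *: basis_vect j + u) @[h --> (0 : R)^'] --> psi u.
  exact: (cvg_comp _ _ cu (psi_continuous Uu)).
have cm k : m k (psi (h *: basis_vect j + u)) @[h --> (0 : R)^'] --> m k (psi u).
  exact: (cvg_comp _ _ cpsi (mc k)).
have NU : \forall h \near (0 : R)^', U (h *: basis_vect j + u).
  exact: (cu _ (open_nbhs_nbhs (conj U_open Uu))).
have NE : \forall h \near (0 : R)^', f (psi (h *: basis_vect j + u)) - f (psi u) =
    \sum_k m k (psi (h *: basis_vect j + u)) * (psi (h *: basis_vect j + u) 0 k - psi u 0 k).
  exact: (cpsi _ mE).
have Nm : \forall h \near (0 : R)^', m i (psi (h *: basis_vect j + u)) != 0.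
  have := cm i; move/cvgrPdist_lt/(_ `|m i (psi u)|); rewrite normr_gt0 => /(_ c0).
  apply: filterS => h; apply: contraTneq => ->; by rewrite subr0 ltxx.
have L : (fun h : R => h^-1 *:
      (((fun u => psi u 0 i) \o shift u) (h *: basis_vect j) - psi u 0 i))
    @ 0^' --> dpsi j u.
  have Eq : \forall h \near (0 : R)^',
     ((j == i)%:R - (j != i)%:R * m j (psi (h *: basis_vect j + u))) *
       (m i (psi (h *: basis_vect j + u)))^-1 =
     h^-1 *: (((fun u => psi u 0 i) \o shift u) (h *: basis_vect j) - psi u 0 i).
    near=> h.
    have h0 : h != 0 by near: h; exact: nbhs_dnbhs_neq.
    have Uh : U (h *: basis_vect j + u) by near: h.
    have mh : m i (psi (h *: basis_vect j + u)) != 0 by near: h.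
    have : f (psi (h *: basis_vect j + u)) - f (psi u) =
      \sum_k m k (psi (h *: basis_vect j + u)) * (psi (h *: basis_vect j + u) 0 k - psi u 0 k).
      by near: h.
    rewrite !f_psi// (bigD1 i)//= !mxE eqxx /= addrK eq_sym.
    rewrite (eq_bigr (fun k => m k (psi (h *: basis_vect j + u)) * (h * (k == j)%:R))); last first.
      by move=> k ki; rewrite !psi_coord// !mxE eqxx /= addrK.
    have -> : \sum_(k | k != i) m k (psi (h *: basis_vect j + u)) * (h * (k == j)%:R) =
        h * ((j != i)%:R * m j (psi (h *: basis_vect j + u))).
      case: (eqVneq j i) => [->|ji].
        rewrite mul0r mulr0 big1 // => k /negbTE ->; by rewrite !mulr0.
      rewrite (bigD1 j)//= eqxx big1 ?addr0; first by rewrite mulr1 mul1r mulrC.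
      by move=> k /andP[_ /negbTE ->]; rewrite !mulr0.
    set A := m i _; set B := m j _; set D := psi _ 0 i - psi _ 0 i => EE.
    apply: (mulIf mh); rewrite -/A mulfVK//; apply: (mulfI h0).
    rewrite mulrBr EE [h^-1 *: _]/(h^-1 * _) -/D.
    by rewrite addrK mulrA mulVKf// mulrC.
  apply: (cvg_trans (near_eq_cvg Eq)).
  rewrite /dpsi -!mz; apply: cvgM.
    by apply: cvgB; [exact: cvg_cst|apply: cvgM; [exact: cvg_cst|exact: cm]].
  by apply: cvgV => //; exact: cm.
split; first exact: cvgP L.
exact: cvg_lim L.
Unshelve. all: by end_near. Qed.

(** A bootstrap: [dpsi] contains [psi] but none of its derivatives, so if [psi] is of class C^n then
    so are its first derivatives. *)
Let psi_smooth : smooth_map_on U psi.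
Proof.
have dn0 z : ball p r z -> 'D_(basis_vect i) f z != 0.
  by move=> /df; apply: contraTneq => ->; rewrite mulr0 ltxx.
have [V1 V2] : open (ball p r) /\ (forall u, U u -> ball p r (psi u)).
  by split=> // u /psiK[].
have cpsi k u : U u -> {for u, continuous (fun u => psi u 0 k)}.
  move=> Uu; apply: (@continuous_comp _ _ _ psi (fun z : vect R => z 0 k)).
    exact: psi_continuous.
  exact: coord_continuous.
suff H n k : Ck n U (fun u => psi u 0 k) by move=> k; apply/smooth_onP => n.
have [->|ki] := eqVneq k i; last first.
  apply: Ck_eq U_open _ (Ck_coord n U k) => u Uu.
  by rewrite psi_coord.
elim: n => [|n IH]; split=> //; do ?by move=> u; exact: cpsi.
move=> j; split=> [u Uu|]; first by case: (is_derive_psi j Uu).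
have IHk l : Ck n U (fun u => psi u 0 l).
  have [->//|li] := eqVneq l i.
  apply: Ck_eq U_open _ (Ck_coord n U l) => u Uu.
  by rewrite psi_coord.
have hD l : Ck n U (fun u => 'D_(basis_vect l) f (psi u)).
  apply: (@Ck_comp R n _ U ('D_(basis_vect l) f) psi V1 U_open V2 IHk).
  exact: (iffLR (smooth_onP _ _) (smooth_partial l sf) n).
have hV : Ck n U (fun u => ('D_(basis_vect i) f (psi u))^-1).
  by apply: CkV => // u /V2; exact: dn0.
have hN : Ck n U (fun u => (j == i)%:R + (- (j != i)%:R) * 'D_(basis_vect j) f (psi u)).
  by apply: CkD => //; [exact: Ck_cst|apply: CkM => //; exact: Ck_cst].
apply: Ck_eq U_open _ (CkM U_open hN hV) => u Uu.
by case: (is_derive_psi j Uu) => _ ->; rewrite /dpsi mulNr.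
Qed.

Lemma straighten_ball :
  exists U psi, diffeo (ball p r) U (fun z => set_coord i z (f z)) psi.
Proof.
exists U, psi; split; [by []|exact: U_open| |exact: psi_smooth|].
- move=> k; have [->|ki] := eqVneq k i.
    by apply: (smooth_eq ball_open_vect _ sf) => z _; rewrite mxE eqxx.
  apply: (smooth_eq ball_open_vect _ (@smooth_coord R _ k)) => z _.
  by rewrite mxE (negbTE ki).
- by split=> [z bz|u /psiK//]; split; [exists z|exact: PhiK].
Qed.

End Inverse.

Lemma straighten W f p i : open W -> W p -> smooth_on W f ->
  'D_(basis_vect i) f p != 0 ->
  exists V U psi, [/\ diffeo V U (fun z => set_coord i z (f z)) psi,
    V p, V `<=` W & forall z, V z -> 'D_(basis_vect i) f z != 0].
Proof.
move=> oW Wp sf d0; pose c : R := 'D_(basis_vect i) f p.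
(* At [p] this product is the square of a non-zero number. *)
have N1 : \forall z \near p, 0 < c * 'D_(basis_vect i) f z.
  apply: continuous_gt0; last by rewrite -expr2 exprn_even_gt0.
  apply: continuousM; first exact: cst_continuous.
  exact: smooth_continuous (smooth_partial i sf) Wp.
have N := @filterI _ _ (nbhs_filter p) _ _ (open_nbhs_nbhs (conj oW Wp)) N1.
have [r /= r0 rP] := iffLR (nbhs_ballP _ _) N.
have sf' : smooth_on (ball p r) f by apply: smooth_sub sf => z /rP[].
have df' z : ball p r z -> 0 < c * 'D_(basis_vect i) f z by move=> /rP[].
have [U [psi h]] := straighten_ball r0 sf' df'.
exists (ball p r), U, psi; split=> //; first exact: ballxx.
  by move=> z /rP[].
by move=> z /df'; apply: contraTneq => ->; rewrite mulr0 ltxx.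
Qed.

End Straighten.

(** * Integration with parameters and the Poincare lemma *)

Section UnitIntegral.
Variable R : realType.
Implicit Types (g h : R -> R) (c e t : R).
Notation mu := (@lebesgue_measure R).

Definition int01 g : R := \int[mu]_(t in `[0, 1]) g t.

(** Continuity is two-sided at the end points as well: the integrands below are functions of all
    real [t], continuous at each point of the closed interval. *)
Definition cont01 g := forall t, 0 <= t <= 1 -> {for t, continuous g}.

Let cont01_within g : cont01 g -> {within `[0, 1], continuous g}.
Proof.
move=> cg; apply: continuous_in_subspaceT => t; rewrite inE /= in_itv /=.
exact: cg.
Qed.

Let cont01_integrable g : cont01 g -> mu.-integrable `[0, 1] (EFin \o g).
Proof.
move=> /cont01_within cg.
by apply: continuous_compact_integrable => //; exact: segment_compact.
Qed.

Lemma int01D g h : cont01 g -> cont01 h ->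
  int01 (fun t => g t + h t) = int01 g + int01 h.
Proof.
by move=> cg ch; rewrite /int01 RintegralD//; exact: cont01_integrable.
Qed.

Lemma int01Z c g : cont01 g -> int01 (fun t => c * g t) = c * int01 g.
Proof.
by move=> cg; rewrite /int01 RintegralZl//; exact: cont01_integrable.
Qed.

Lemma cont01_cst c : cont01 (fun=> c).
Proof. by move=> t _; exact: cst_continuous. Qed.

Lemma cont01D g h : cont01 g -> cont01 h -> cont01 (fun t => g t + h t).
Proof. by move=> cg ch t t01; exact: continuousD (cg t t01) (ch t t01). Qed.

Lemma cont01M g h : cont01 g -> cont01 h -> cont01 (fun t => g t * h t).
Proof. by move=> cg ch t t01; exact: continuousM (cg t t01) (ch t t01). Qed.

Lemma int01_le g h e : cont01 g -> cont01 h ->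
  (forall t, 0 <= t <= 1 -> g t <= h t + e) -> int01 g <= int01 h + e.
Proof.
move=> cg ch gh.
have -> : int01 h + e = int01 (fun t => h t + e).
  rewrite int01D//; last exact: cont01_cst.
  congr (_ + _).
  by rewrite /int01 Rintegral_cst//= lebesgue_measure_itv /= lte01 sube0 mulr1.
apply: le_Rintegral => //.
- exact: cont01_integrable.
- by apply: cont01_integrable; apply: cont01D => //; exact: cont01_cst.
Qed.

Lemma int01_dist g h e : cont01 g -> cont01 h ->
  (forall t, 0 <= t <= 1 -> `|g t - h t| <= e) -> `|int01 g - int01 h| <= e.
Proof.
move=> cg ch gh; have h1 : int01 g <= int01 h + e.
  apply: int01_le => // t /gh; rewrite ler_norml; lra.
have h2 : int01 h <= int01 g + e.
  apply: int01_le => // t /gh; rewrite ler_norml; lra.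
by rewrite ler_norml; move: (int01 g) (int01 h) h1 h2 => x y; lra.
Qed.

Lemma int01_FTC (F f : R -> R) : cont01 f ->
  (forall t, 0 <= t <= 1 -> is_derive t 1 F (f t)) -> int01 f = F 1 - F 0.
Proof.
move=> cf dF.
have cF t : 0 <= t <= 1 -> {for t, continuous F}.
  move=> t01; apply/differentiable_continuous/derivable1_diffP.
  by case: (dF t t01).
rewrite /int01 /Rintegral (@continuous_FTC2 _ f F)//.
- exact: cont01_within.
- split.
  + move=> t; rewrite in_itv /= => /andP[t0 t1].
    by have [] := dF t; rewrite ?(ltW t0) ?(ltW t1).
  + by apply: cvg_at_right_filter; apply: cF; rewrite lexx ler01.
  + by apply: cvg_at_left_filter; apply: cF; rewrite lexx ler01.
- move=> t; rewrite in_itv /= => /andP[t0 t1]; rewrite derive1E.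
  by have [] := dF t; rewrite ?(ltW t0) ?(ltW t1).
Qed.

End UnitIntegral.

(** * Contraction integrals and closed forms with parameters *)

Section Poincare.
Variable R : realType.
Implicit Types (F : vect R -> R) (x v z u : vect R) (t e : R).
Variables (a : pred 'I_3) (p : vect R) (r : R).
Hypothesis r0 : 0 < r.
Let W : set (vect R) := ball p r.

Let oW : open W. Proof. exact: ball_open. Qed.

(** The balls of [vect R] are cubes, so they are preserved when only the coordinates in [a] move
    towards those of the centre. The map is the identity at [t = 1]. *)
Definition contract t z : vect R :=
  \row_k if a k then p 0 k + t * (z 0 k - p 0 k) else z 0 k.

(** The weight [t ^+ m] makes the family stable under differentiation: each derivative in a
    contracted direction brings out one factor [t], each derivative in another direction none. The
    exponent thus grows by the boolean [a j]. *)
Definition contract_int (m : nat) F z : R :=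
  int01 (fun t => t ^+ m * F (contract t z)).

Let contract_ball z t : W z -> 0 <= t <= 1 -> W (contract t z).
Proof.
move=> /(ball_vectP _ _ r0) bz /andP[t0 t1]; apply/(ball_vectP _ _ r0) => k.
rewrite mxE; case: ifP => // _.
rewrite opprD addrA subrr add0r normrN normrM (ger0_norm t0) distrC.
by rewrite (le_lt_trans _ (bz k))// ler_piMl.
Qed.

Let continuous_contract t z :
  {for (t, z), continuous (fun q : R * vect R => contract q.1 q.2)}.
Proof.
apply: continuous_vect => k.
have c2 : {for (t, z), continuous (fun q : R * vect R => q.2 0 k)}.
  apply: (@continuous_comp _ _ _ snd (fun y : vect R => y 0 k)).
    exact: cvg_snd.
  exact: coord_continuous.
case ak : (a k); last first.
  by rewrite (_ : (fun _ => _) = (fun q : R * vect R => q.2 0 k))//;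
    apply/funext => q; rewrite mxE ak.
rewrite (_ : (fun _ => _) =
  (fun q : R * vect R => p 0 k + q.1 * (q.2 0 k - p 0 k))); last first.
  by apply/funext => q; rewrite mxE ak.
apply: continuousD; first exact: cst_continuous.
apply: continuousM; first exact: cvg_fst.
by apply: continuousB => //; exact: cst_continuous.
Qed.

Let continuous_joint F t z : (forall y, W y -> {for y, continuous F}) -> W z ->
  0 <= t <= 1 ->
  {for (t, z), continuous (fun q : R * vect R => F (contract q.1 q.2))}.
Proof.
move=> cF Wz t01.
apply: (@continuous_comp _ _ _ (fun q : R * vect R => contract q.1 q.2) F).
  exact: continuous_contract.
by apply: cF; exact: contract_ball.
Qed.

Let continuous_slice F t z : (forall y, W y -> {for y, continuous F}) -> W z ->
  0 <= t <= 1 -> {for t, continuous (fun s => F (contract s z))}.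
Proof.
move=> cF Wz t01.
exact: (@continuous2_cvg _ _ _ _ (nbhs t) _ (fun s : R => s) (fun=> z)
  (fun s y => F (contract s y)) _ _ (continuous_joint cF Wz t01)
  cvg_id (cvg_cst _)).
Qed.

Let cont01_integrand m F z : (forall y, W y -> {for y, continuous F}) -> W z ->
  cont01 (fun t => t ^+ m * F (contract t z)).
Proof.
move=> cF Wz; apply: cont01M.
  by move=> t _; exact: exprn_continuous.
by move=> t; exact: continuous_slice.
Qed.

(* Tube lemma over the compact interval of integration. *)
Let uniform F z e : (forall y, W y -> {for y, continuous F}) -> W z -> 0 < e ->
  exists2 d : R, 0 < d & forall z', ball z d z' -> W z' /\
    forall t, 0 <= t <= 1 -> `|F (contract t z') - F (contract t z)| < e.
Proof.
move=> cF Wz e0.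
have e20 : 0 < e / 2 by rewrite divr_gt0.
have /compact_near_coveringP cov := @segment_compact R 0 1.
have N : \forall z' \near z, `[0, 1] `<=`
    (fun t => `|F (contract t z') - F (contract t z)| < e).
  apply: (cov _ (nbhs z) (fun z' t => `|F (contract t z') - F (contract t z)| < e)).
  move=> t; rewrite /= in_itv /= => t01.
  have h1 := (iffLR (continuous_dist _ _) (continuous_joint cF Wz t01)) _ e20.
  have h2 := (iffLR (continuous_dist _ _) (continuous_slice cF Wz t01)) _ e20.
  case: h1 => -[A B] [/= tA zB AB].
  exists (A `&` [set s | `|F (contract t z) - F (contract s z)| < e / 2], B).
    by split=> //=; exact: (@filterI _ _ (nbhs_filter t)).
  move=> [s z'] [/= [As hs] Bz'].
  have := AB (s, z') (conj As Bz'); move: hs; rewrite /=.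
  move: (F _) (F _) (F _) => x1 x2 x3; rewrite !ltr_norml; lra.
have N2 : nbhs z W by exact: open_nbhs_nbhs.
have [d /= d0 dP] := iffLR (nbhs_ballP _ _) (@filterI _ _ (nbhs_filter z) _ _ N2 N).
exists d => // z' /dP[Wz' h]; split=> // t t01; apply: h.
Qed.

Let expr_le1 m t : 0 <= t <= 1 -> `|t ^+ m| <= 1.
Proof. by move=> /andP[t0 t1]; rewrite ger0_norm ?exprn_ge0// exprn_ile1. Qed.

Let continuous_contract_int m F z : (forall y, W y -> {for y, continuous F}) ->
  W z -> {for z, continuous (contract_int m F)}.
Proof.
move=> cF Wz; apply/continuous_dist => e e0.
have e20 : 0 < e / 2 by rewrite divr_gt0.
have [d d0 dP] := uniform cF Wz e20.
apply/nbhs_ballP; exists d => // z' /dP[Wz' h].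
apply: (@le_lt_trans _ _ (e / 2)); last by rewrite ltr_pdivrMr// ltr_pMr// ltr1n.
apply: int01_dist; [exact: cont01_integrand|exact: cont01_integrand|].
move=> t t01; rewrite -mulrBr normrM distrC.
rewrite (le_trans _ (ltW (h t t01)))//.
by rewrite ler_piMl//; exact: expr_le1.
Qed.

Let contract_line t z j (h : R) :
  contract t (h *: basis_vect j + z) = (t ^+ a j * h) *: basis_vect j + contract t z.
Proof.
apply/rowP => k; rewrite !mxE eqxx /=.
case: (eqVneq k j) => [->|_]; last by rewrite !mulr0 !add0r.
by case: ifP => aj; rewrite ?expr1 ?expr0; ring.
Qed.

(** Differentiation under the integral sign. For each [t] the mean value theorem writes the
    difference quotient of the integrand as [t ^+ (m + a j)] times the partial derivative at a
    shifted point, and [uniform] bounds the effect of the shift for all [t] at once. *)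
Let is_derive_contract_int m F z j : Ck 1 W F -> W z ->
  is_derive z (basis_vect j) (contract_int m F)
    (contract_int (m + a j) ('D_(basis_vect j) F) z).
Proof.
move=> cF Wz.
have cF0 y : W y -> {for y, continuous F} by exact: Ck_cont cF.
have cD y : W y -> {for y, continuous ('D_(basis_vect j) F)}.
  exact: Ck_cont (Ck_partial j cF).
have L : (fun h : R => h^-1 *:
      ((contract_int m F \o shift z) (h *: basis_vect j) - contract_int m F z))
    @ 0^' --> contract_int (m + a j) ('D_(basis_vect j) F) z.
  apply/cvgrPdist_le => /= e e0.
  have [d d0 dP] := uniform cD Wz e0.
  near=> h.
  have h0 : h != 0 by near: h; exact: nbhs_dnbhs_neq.
  have hd : `|h| < d by near: h; exact: dnbhs0_lt.
  have bh (s : R) : 0 <= s <= 1 -> ball z d ((s * h) *: basis_vect j + z).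
    move=> /andP[s0 s1]; apply/(ball_vectP _ _ d0) => k; rewrite !mxE eqxx /=.
    rewrite opprD addrCA subrr addr0 normrN normrM.
    case: (k == j); rewrite ?normr1 ?normr0 ?mulr1 ?mulr0//.
    by rewrite normrM ger0_norm// (le_lt_trans _ hd)// ler_piMl.
  have Wh (s : R) : 0 <= s <= 1 -> W ((s * h) *: basis_vect j + z).
    by move=> /bh/dP[].
  have Wzh : W (h *: basis_vect j + z).
    by have := Wh 1; rewrite mul1r; apply; rewrite ler01 lexx.
  rewrite distrC /=; set quot := (X in `|X - _|).
  have -> : quot =
     int01 (fun t => h^-1 * (t ^+ m * F (contract t (h *: basis_vect j + z)) +
                      -1 * (t ^+ m * F (contract t z)))).
    have c1 := @cont01_integrand m _ _ cF0 Wzh.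
    have c2 := @cont01_integrand m _ _ cF0 Wz.
    have c3 := cont01M (@cont01_cst R (-1)) c2.
    rewrite int01Z; last exact: cont01D.
    by rewrite int01D// int01Z// mulN1r.
  apply: int01_dist.
  - apply: (cont01M (@cont01_cst R h^-1)); apply: cont01D.
      exact: cont01_integrand.
    apply: (cont01M (@cont01_cst R (-1))); exact: cont01_integrand.
  - exact: (@cont01_integrand _ ('D_(basis_vect j) F)).
  move=> t t01; rewrite contract_line.
  set v : vect R := _ *: basis_vect j.
  have linev s : s *: v + contract t z = contract t ((s * h) *: basis_vect j + z).
    by rewrite contract_line /v scalerA; congr (_ *: _ + _); ring.
  have dv s : 0 <= s <= 1 -> is_derive (s *: v + contract t z) v F
      (t ^+ a j * h * 'D_(basis_vect j) F (contract t ((s * h) *: basis_vect j + z))).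
    move=> s01; rewrite -linev; apply: is_derive_scale.
    by apply: Ck_derivable cF _; rewrite linev; apply: contract_ball => //; exact: Wh.
  have [|s s01 E] := @MVT_line _ F (contract t z) v.
    by move=> s s01; case: (dv s s01).
  rewrite mulN1r -mulrBr E; case: (dv s s01) => _ ->.
  have [_ /(_ t t01) le] := dP _ (bh s s01).
  rewrite exprD.
  move: le (expr_le1 m t01) (expr_le1 (a j) t01).
  move: ('D_(basis_vect j) F _) ('D_(basis_vect j) F _) (t ^+ m) (t ^+ a j) => y x q1 q2 le l1 l2.
  set lhs := (X in `|X| <= _); have -> : lhs = q1 * q2 * (x - y).
    suff : h^-1 * (q1 * (q2 * h * x)) - q1 * q2 * y = q1 * q2 * (x - y) by [].
    by field.
  rewrite normrM (le_trans _ (ltW le))// ler_piMl// normrM.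
  by rewrite mulr_ile1.
split; first exact: cvgP L.
exact: cvg_lim L.
Unshelve. all: by end_near. Qed.

Let Ck_contract_int n m F : Ck n W F -> Ck n W (contract_int m F).
Proof.
elim: n m F => [|n IH] m F cF.
  by split=> // z; apply: continuous_contract_int => y; exact: Ck_cont cF.
split; first by move=> z; apply: continuous_contract_int => y; exact: Ck_cont cF.
have cF1 : Ck 1 W F by elim: (n) cF => // k IHk /CkS.
move=> j; split=> [z Wz|]; first by case: (is_derive_contract_int m j cF1 Wz).
apply: Ck_eq oW _ (IH (m + a j)%N _ (Ck_partial j cF)) => z Wz.
by case: (is_derive_contract_int m j cF1 Wz).
Qed.

Lemma smooth_contract_int m F : smooth_on W F -> smooth_on W (contract_int m F).
Proof.
move=> /smooth_onP sF; apply/smooth_onP => n; exact: Ck_contract_int.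
Qed.

Let eq_contract_int m (F G : vect R -> R) z : W z ->
  (forall y, W y -> F y = G y) -> contract_int m F z = contract_int m G z.
Proof.
move=> Wz FG; apply: eq_Rintegral => t; rewrite inE /= in_itv /= => t01.
by rewrite FG//; exact: contract_ball.
Qed.

Let dcontract t z k : is_derive t (1 : R) (fun s => contract s z 0 k)
  ((a k)%:R * (z 0 k - p 0 k)).
Proof.
case ak : (a k); last first.
  rewrite (_ : (fun s => _) = (fun=> z 0 k)) ?mul0r; first exact: is_derive_cst.
  by apply/funext => s; rewrite mxE ak.
rewrite (_ : (fun s => _) = (fun s => p 0 k + s * (z 0 k - p 0 k))); last first.
  by apply/funext => s; rewrite mxE ak.
apply: is_derive_eq (is_derive_add (is_derive_cst _ _ _)
  (is_derive_mul (is_derive_id _ _) (is_derive_cst _ _ _))) _.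
by rewrite add0r mulr0 addr0.
Qed.

(** The integrand is the derivative of [t * G (contract t z)], which vanishes at [t = 0] and is
    [G z] at [t = 1]; the product rule gives the term without weight and the terms of weight [t]. *)
Let contract_FTC (G : vect R -> R) (D : 'I_3 -> vect R -> R) (w : 'I_3 -> R) z :
  W z -> (forall y, W y -> {for y, continuous G}) ->
  (forall k y, W y -> {for y, continuous (D k)}) ->
  (forall t, 0 <= t <= 1 -> is_derive t (1 : R) (fun s => G (contract s z))
     (\sum_k D k (contract t z) * w k)) ->
  contract_int 0 G z + \sum_k w k * contract_int 1 (D k) z = G z.
Proof.
move=> Wz cG cD dG.
have c1 k := @cont01_integrand 1 _ _ (cD k) Wz.
have c2 k : cont01 (fun t => w k * (t ^+ 1 * D k (contract t z))).
  by apply: (cont01M (@cont01_cst R (w k))); exact: c1.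
have c0 := @cont01_integrand 0 _ _ cG Wz.
rewrite !big_ord_recr big_ord0 /= add0r -!int01Z//.
have c22 := cont01D (c2 (widen_ord (leqnSn 2) (widen_ord (leqnSn 1) ord_max)))
  (c2 (widen_ord (leqnSn 2) ord_max)).
have c222 := cont01D c22 (c2 ord_max).
rewrite -int01D// -int01D// -int01D//.
have E := @int01_FTC R (fun t => t * G (contract t z)) _ (cont01D c0 c222).
apply: etrans (E _) _ => [t t01|].
  apply: is_derive_eq (is_derive_mul (is_derive_id t 1) (dG t t01)) _.
  rewrite expr0 !big_ord_recr big_ord0 /=.
  by ring.
rewrite mul0r subr0 mul1r; congr G.
by apply/rowP => k; rewrite mxE; case: ifP => // _; ring.
Qed.

(* The homotopy operator applied to [\sum_(k | a k) F k dx_k], the coordinates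
   outside [a] being parameters. *)
Lemma poincare (F : 'I_3 -> vect R -> R) :
  (forall k, a k -> smooth_on W (F k)) ->
  (forall j k z, a j -> a k -> W z ->
     'D_(basis_vect j) (F k) z = 'D_(basis_vect k) (F j) z) ->
  exists2 f : vect R -> R, smooth_on W f &
    forall k z, a k -> W z -> 'D_(basis_vect k) f z = F k z.
Proof.
move=> sF0 closed0.
(* The form is extended by zero in the parameter directions, so that all three components are
   smooth. *)
pose F' k := if a k then F k else fun=> 0.
have sF k : smooth_on W (F' k).
  by rewrite /F'; case: ifP => [/sF0//|_]; exact: smooth_cst.
have F'E k : a k -> F' k = F k by rewrite /F' => ->.
have closed j k z : a j -> a k -> W z ->
    'D_(basis_vect j) (F' k) z = 'D_(basis_vect k) (F' j) z.
  by move=> aj ak; rewrite !F'E//; exact: closed0.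
pose dz k z : R := (a k)%:R * (z 0 k + - p 0 k).
pose f z := \sum_k dz k z * contract_int 0 (F' k) z.
have sdz k : smooth_on W (dz k).
  apply: (smooth_mul oW (@smooth_cst _ _ _)).
  by apply: (smooth_add oW (@smooth_coord _ _ _)); exact: smooth_cst.
have ddz z j k : is_derive z (basis_vect j) (dz k) ((a k)%:R * (k == j)%:R).
  have d1 := is_derive_add (is_derive_coord z (basis_vect j) k)
    (@is_derive_cst _ _ _ (- p 0 k) z (basis_vect j)).
  have d2 := is_derive_mul (@is_derive_cst _ _ _ ((a k)%:R : R) z (basis_vect j)) d1.
  apply: is_derive_eq d2 _.
  by rewrite mul0r add0r mxE eqxx addr0.
exists f.
  apply/smooth_onP => n.
  apply: (@Ck_sum R n W _ _ (fun k z => dz k z * contract_int 0 (F' k) z) oW) => k.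
  apply: (CkM oW); first exact: (iffLR (smooth_onP _ _) (sdz k)).
  exact: (iffLR (smooth_onP _ _) (smooth_contract_int 0 (sF k))).
move=> j z aj Wz.
have cF k := iffLR (smooth_onP _ _) (sF k).
have [D DE] : exists D : 'I_3 -> 'I_3 -> vect R -> R,
    forall i k, 'D_(basis_vect i) (F' k) = D i k.
  by exists (fun i k => 'D_(basis_vect i) (F' k)).
have cD i k y : W y -> {for y, continuous (D i k)}.
  by rewrite -DE; exact: Ck_cont (Ck_partial i (cF k 1%N)).
have closedD k y : a k -> W y -> D j k y = D k j y.
  by move=> ak Wy; rewrite -!DE; exact: closed.
have := is_derive_bigsum (fun k => is_derive_mul (ddz z j k)
   (is_derive_contract_int 0 j (cF k 1%N) Wz)).
rewrite -/f => -[_ ->].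
rewrite add0n aj big_split /= (bigD1 j)//= aj eqxx mul1r mul1r big1 ?addr0; last first.
  by move=> k /negbTE ->; rewrite mulr0 mul0r.
rewrite -(F'E j aj) -[RHS](@contract_FTC (F' j) (fun k => D k j) (fun k => dz k z) z Wz).
- congr (_ + _); apply: eq_bigr => k _; rewrite DE.
  (* For [k] in [a], closedness turns [D_j F_k] into [D_k F_j], the derivative that occurs along the
     contraction; for the other [k] the factor [dz k] is zero. *)
  have [ak|ak] := boolP (a k).
    congr (_ * _); apply: eq_contract_int => // y; exact: closedD.
  by rewrite /dz (negbTE ak) !mul0r.
- by move=> y; exact: Ck_cont (cF j 0%N).
- by move=> k y; exact: cD.
- move=> t t01.
  have := @is_derive_comp_smooth R _ W (F' j) (fun s => contract s z) t 1 _ oW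
    (contract_ball Wz t01) (sF j) (dcontract t z).
  move=> h; apply: is_derive_eq h _; apply: eq_bigr => k _.
  congr (_ * _); exact: (congr1 (fun g : vect R -> R => g (contract t z)) (DE k j)).
Qed.

End Poincare.

(** * Flat coordinates in R^3 *)

Section Flatten.
Variable R : realType.
Implicit Types (W U V : set (vect R)) (f : vect R -> R) (z v u : vect R).

Lemma mem_ijk (i j k l : 'I_3) : uniq [:: i; j; k] -> l \in [:: i; j; k].
Proof.
move=> us; have [_ E] := uniq_min_size us (fun x _ => mem_enum 'I_3 x)
  (eq_leq (size_enum_ord 3)).
by rewrite E mem_enum.
Qed.

Lemma sum_ijk (i j k : 'I_3) (F : 'I_3 -> R) : uniq [:: i; j; k] ->
  \sum_l F l = F i + F j + F k.
Proof.
move=> us; have E : perm_eq (index_enum 'I_3) [:: i; j; k].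
  apply: uniq_perm => //; first exact: index_enum_uniq.
  by move=> x; rewrite mem_index_enum mem_ijk.
by rewrite (perm_big _ E) /= !big_cons big_nil addr0 addrA.
Qed.

Lemma diffeo_comp V W V' W' (x y x' y' : vect R -> vect R) :
  diffeo V W x y -> diffeo V' W' x' y' ->
  diffeo (V `&` x @^-1` V') (W' `&` y' @^-1` W) (x' \o x) (y \o y').
Proof.
move=> [oV oW sx sy [xy yx]] [oV' oW' sx' sy' [xy' yx']].
have o1 : open (V `&` x @^-1` V').
  exact: (open_preimage oV oV' (fun z Vz => smooth_map_continuous sx Vz)).
have o2 : open (W' `&` y' @^-1` W).
  exact: (open_preimage oW' oW (fun z Wz => smooth_map_continuous sy' Wz)).
split=> //.
- move=> k; apply: (@smooth_comp _ V' _ (fun z => x' z 0 k) x oV' o1 _ _ (sx' k)).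
    by move=> z [].
  by move=> l; apply: smooth_sub (sx l) => z [].
- move=> k; apply: (@smooth_comp _ W _ (fun z => y z 0 k) y' oW o2 _ _ (sy k)).
    by move=> z [].
  by move=> l; apply: smooth_sub (sy' l) => z [].
- split=> [z [Vz V'z]|u [W'u Wu]] /=.
    have [Wx yxz] := xy z Vz; have [W'x yxz'] := xy' _ V'z.
    by rewrite yxz' yxz.
  have [V'y xyu] := yx' u W'u; have [Vy xyu'] := yx _ Wu.
  by rewrite xyu' xyu.
Qed.

(** Implicit differentiation again, now for any inverse: off [i] the components of [psi u] are those
    of [u], and [f (psi u) = u_i] is differentiated by the chain rule and solved for the remaining
    entry. *)
Lemma partial_set_coord V U f psi i u m : smooth_on V f ->
  diffeo V U (fun z => set_coord i z (f z)) psi -> U u ->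
  (forall z, V z -> 'D_(basis_vect i) f z != 0) ->
  (forall l, l != i -> 'D_(basis_vect m) (fun y => psi y 0 l) u = (m == l)%:R) /\
  'D_(basis_vect m) (fun y => psi y 0 i) u =
    (if m == i then 1 else - 'D_(basis_vect m) f (psi u)) /
    'D_(basis_vect i) f (psi u).
Proof.
move=> sf [oV oU _ spsi [_ psiP]] Uu f0.
have Dl l : l != i -> 'D_(basis_vect m) (fun y => psi y 0 l) u = (m == l)%:R.
  move=> li; rewrite -(@near_eq_derive _ _ _ (fun y : vect R => y 0 l)).
    have [_ ->] := is_derive_coord u (basis_vect m) l.
    by rewrite mxE eqxx eq_sym.
  apply: near_open oU Uu _ => y /psiP[_ /rowP/(_ l)].
  by rewrite mxE (negbTE li).
split=> //.
have [Vpsi _] := psiP u Uu.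
have D k : is_derive u (basis_vect m) (fun y => psi y 0 k)
    ('D_(basis_vect m) (fun y => psi y 0 k) u).
  exact: smooth_derivable (spsi k) Uu.
have [_ E] := is_derive_comp_smooth oV Vpsi sf D.
rewrite -(@near_eq_derive _ _ _ (fun y : vect R => y 0 i)) in E; last first.
  apply: near_open oU Uu _ => y /psiP[_ /rowP/(_ i)].
  by rewrite mxE eqxx.
move: E; have [_ ->] := is_derive_coord u (basis_vect m) i.
rewrite mxE eqxx /= (bigD1 i)//= => E.
have := f0 _ Vpsi; move: E; rewrite [i == m]eq_sym.
set Dm := 'D_(basis_vect m) (fun y => psi y 0 i) u.
set fi := 'D_(basis_vect i) f (psi u) => E fi0.
suff ES : \sum_(l | l != i) 'D_(basis_vect l) f (psi u) *
    'D_(basis_vect m) (fun y => psi y 0 l) u =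
    if m == i then 0 else 'D_(basis_vect m) f (psi u).
  apply: (mulfI fi0); rewrite mulrCA mulfV// mulr1.
  move: E; rewrite ES; case: ifP => _ E; first by rewrite [RHS]E addr0.
  by apply/eqP; rewrite -addr_eq0 -E.
case: eqVneq => [mi|mi].
  rewrite big1 // => l li; rewrite Dl// mi.
  by rewrite eq_sym (negbTE li) mulr0.
rewrite (bigD1 m)//= Dl// eqxx mulr1 big1 ?addr0// => l /andP[li lm].
by rewrite Dl// eq_sym (negbTE lm) mulr0.
Qed.

(* Closedness of [(A_k dx_j - A_j dx_k) / w_i] on the leaves [f = const], where
   [df = w] and [x_j, x_k] are the coordinates; [djAk] is the value of the j-th
   partial derivative of [A_k]. *)
Let leaf_closed (Ai Aj Ak wi wj wk diAi djAj dkAk diAj diAk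
    diwi djwi dkwi : R) : wi != 0 ->
  wi * Ai + wj * Aj + wk * Ak = 0 ->
  (diwi * Ai + wi * diAi) + (djwi * Aj + wj * diAj) + (dkwi * Ak + wk * diAk) = 0 ->
  diAi + djAj + dkAk = 0 ->
  - ((diAj * wi^-1 + Aj * (- diwi / wi ^+ 2)) * (- wj / wi) +
     (djAj * wi^-1 + Aj * (- djwi / wi ^+ 2))) =
  (diAk * wi^-1 + Ak * (- diwi / wi ^+ 2)) * (- wk / wi) +
     (dkAk * wi^-1 + Ak * (- dkwi / wi ^+ 2)).
Proof.
move=> wi0 H1 H2 H3; apply/eqP; rewrite -subr_eq0; apply/eqP.
(* The difference of the two sides is a combination of [w . A], of its derivative along [x_i], and
   of the divergence of [A]. In the second of these, [d_j w_i] and [d_k w_i] stand for [d_i w_j] and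
   [d_i w_k]. *)
transitivity ((wi * ((diwi * Ai + wi * diAi) + (djwi * Aj + wj * diAj) +
   (dkwi * Ak + wk * diAk)) - diwi * (wi * Ai + wj * Aj + wk * Ak)
   - wi ^+ 2 * (diAi + djAj + dkAk)) / wi ^+ 3); first by field.
by rewrite H1 H2 H3 !mulr0 !subr0 mul0r.
Qed.

(* [E1], [E2], [E3] are the Jacobians of the inverses of the three successive
   coordinate changes, [w], [g] and [t] the gradients of the new coordinates. *)
Let frame_algebra (i j k : 'I_3) (w X g t : 'I_3 -> R) (rho : R)
    (E1 E2 E3 : 'I_3 -> 'I_3 -> R) :
  uniq [:: i; j; k] -> w i != 0 -> X k != 0 -> rho != 0 ->
  \sum_l w l * X l = 0 ->
  g j = rho * X k / w i -> g k = - (rho * X j / w i) -> t k = (X k)^-1 ->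
  (forall n l, l != i -> E1 n l = (n == l)%:R) ->
  (forall n, E1 n i = (if n == i then 1 else - w n) / w i) ->
  (forall n l, l != j -> E2 n l = (n == l)%:R) ->
  (forall n, E2 n j = (if n == j then 1 else - g n) / g j) ->
  (forall n l, l != k -> E3 n l = (n == l)%:R) ->
  (forall n, E3 n k = (if n == k then 1 else - t n) / t k) ->
  let c m l := \sum_n E1 n l * (\sum_q E2 q n * E3 m q) in
  [/\ forall m, \sum_l w l * c m l = (m == i)%:R,
      forall l, c k l = X l &
      rho * (c i i * (c j j * c k k - c j k * c k j)
           - c i j * (c j i * c k k - c j k * c k i)
           + c i k * (c j i * c k j - c j j * c k i)) = 1].
Proof.
move=> us wi0 Xk0 rho0 wX gj gk tk E1l E1i E2l E2j E3l E3k c.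
move: (us); rewrite /= !inE !negb_or andbT => /andP[/andP[ij ik] jk].
have [ji ki kj] : [/\ j != i, k != i & k != j] by rewrite ![_ == i]eq_sym [k == j]eq_sym.
have S (F : 'I_3 -> R) : \sum_l F l = F i + F j + F k := sum_ijk F us.
have [nij nik njk nji [nki nkj]] : [/\ (i == j) = false, (i == k) = false,
   (j == k) = false, (j == i) = false & (k == i) = false /\ (k == j) = false].
  by rewrite !(negbTE ij, negbTE ik, negbTE jk, negbTE ji, negbTE ki, negbTE kj).
have gj0 : g j != 0 by rewrite gj !mulf_neq0// invr_eq0.
have inner_i m : \sum_q E2 q i * E3 m q = E3 m i.
  by rewrite S !E2l// eqxx nji nki mul1r !mul0r !addr0.
have inner_k m : \sum_q E2 q k * E3 m q = E3 m k.
  by rewrite S !E2l// eqxx nik njk mul1r !mul0r !add0r.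
have inner_j m : \sum_q E2 q j * E3 m q =
    (- g i * E3 m i + E3 m j - g k * E3 m k) / g j.
  by rewrite S !E2j nij nkj eqxx; field.
have cj m : c m j = (- g i * E3 m i + E3 m j - g k * E3 m k) / g j.
  by rewrite /c S !E1l// nij nkj eqxx inner_j mul1r !mul0r add0r addr0.
have ck m : c m k = E3 m k.
  by rewrite /c S !E1l// nik njk eqxx inner_k mul1r !mul0r !add0r.
have ci m : c m i = (E3 m i - w j * c m j - w k * c m k) / w i.
  rewrite /c S !E1i eqxx nji nki inner_i inner_k -/(c m j) -/(c m k) cj ck inner_j.
  by field; rewrite wi0.
have Xi : X i = (- w j * X j - w k * X k) / w i.
  apply: (mulfI wi0); rewrite mulrCA mulfV// mulr1; apply/eqP.
  by rewrite -subr_eq0 -wX S; apply/eqP; ring.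
have E3ki : E3 k i = 0 by rewrite E3l// nki.
have E3kj : E3 k j = 0 by rewrite E3l// nkj.
have E3kk : E3 k k = X k by rewrite E3k eqxx tk invrK mul1r.
(* Here the shape of [g] is used: [g_k / g_j = - X_j / X_k], so that moving along the last
   coordinate with [g] fixed follows [X]. *)
have ckj : c k j = X j.
  by rewrite cj E3ki E3kj E3kk gk gj; field; rewrite wi0 Xk0 rho0.
have ckk : c k k = X k by rewrite ck.
have cki : c k i = X i.
  by rewrite ci ckj ckk E3ki Xi; field.
have cij : c i j = (- g i - g k * c i k) / g j.
  by rewrite cj ck (E3l _ _ ik) (E3l _ _ jk) nij eqxx mulr1 addr0.
have cjj : c j j = (1 - g k * c j k) / g j.
  by rewrite cj ck (E3l _ _ ik) (E3l _ _ jk) nji eqxx mulr0 add0r.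
have cii : c i i = (1 - w j * c i j - w k * c i k) / w i.
  by rewrite ci E3l// eqxx.
have cji : c j i = (- w j * c j j - w k * c j k) / w i.
  by rewrite ci E3l// nji sub0r mulNr.
split.
- move=> m; rewrite S ci -(E3l m i ik).
  by move: (c m j) (c m k) (E3 m i) => x1 x2 x3; field.
- by move=> l; have := mem_ijk l us; rewrite !inE => /or3P[] /eqP ->.
(* The three inverse Jacobians have determinants [1 / w_i], [1 / g_j] and [1 / t_k]; their product
   [(1 / w_i) (w_i / (rho X_k)) X_k] is [1 / rho]. *)
- rewrite cki ckj ckk cii cji cij cjj Xi gk gj.
  move: (c i k) (c j k) (g i) => x1 x2 x3; field.
  by rewrite wi0 Xk0 rho0.
Qed.
(** Once [f] has replaced [x_i], the [m]-th coordinate field becomes [D_m - (D_m f / D_i f) D_i],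
    the lift of [D_m] that is tangent to the leaves [f = const]. *)
Let is_derive_pullback (B V1 U1 : set (vect R)) (f q : vect R -> R) psi i u m
    (Dq : 'I_3 -> R) : open B -> V1 `<=` B -> smooth_on V1 f -> smooth_on B q ->
  diffeo V1 U1 (fun z => set_coord i z (f z)) psi -> U1 u ->
  (forall z, V1 z -> 'D_(basis_vect i) f z != 0) -> m != i ->
  (forall n, is_derive (psi u) (basis_vect n) q (Dq n)) ->
  is_derive u (basis_vect m) (fun y => q (psi y))
    (Dq i * (- 'D_(basis_vect m) f (psi u) / 'D_(basis_vect i) f (psi u)) + Dq m).
Proof.
move=> oB VB sf sq D U1u f0 mi dq.
have [_ _ _ spsi [_ psiP]] := D.
have [Vpsi _] := psiP u U1u.
have Dpsi l : is_derive u (basis_vect m) (fun y => psi y 0 l)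
    ('D_(basis_vect m) (fun y => psi y 0 l) u).
  exact: smooth_derivable (spsi l) U1u.
have [dl di] := partial_set_coord m sf D U1u f0.
have h := is_derive_comp_smooth oB (VB _ Vpsi) sq Dpsi.
apply: is_derive_eq h _.
rewrite (bigD1 i)//= di (negbTE mi) (bigD1 m)//= dl// eqxx mulr1 big1 ?addr0.
  by congr (_ * _ + _); [case: (dq i)|case: (dq m)].
by move=> l /andP[li lm]; rewrite dl// eq_sym (negbTE lm) mulr0.
Qed.

(** The vector [c m] is the [m]-th coordinate field of the new chart. The conclusions say that
    [omega] takes the value 1 on the [i]-th field and 0 on the others, that the [k]-th field is [X],
    and that [Omega] is 1 on the fields [i], [j], [k]: the frame conditions, with [i], [j], [k] in
    place of 0, 1, 2. *)
Lemma flat_coordinates U p (i j k : 'I_3) (w X : 'I_3 -> vect R -> R) (rho : vect R -> R) :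
  open U -> U p -> uniq [:: i; j; k] ->
  (forall l, smooth_on U (w l)) -> (forall l, smooth_on U (X l)) ->
  smooth_on U rho ->
  (forall a b z, U z ->
     'D_(basis_vect a) (w b) z = 'D_(basis_vect b) (w a) z) ->
  (forall z, U z -> \sum_l w l z * X l z = 0) ->
  (forall z, U z -> \sum_l 'D_(basis_vect l) (fun y => rho y * X l y) z = 0) ->
  (forall z, U z -> rho z != 0) -> w i p != 0 -> X k p != 0 ->
  exists V W x y, [/\ diffeo V W x y, V p, V `<=` U & forall u, W u ->
    let c m l := 'D_(basis_vect m) (fun y' => y y' 0 l) u in
    [/\ forall m, \sum_l w l (y u) * c m l = (m == i)%:R,
      forall l, c k l = X l (y u) &
      rho (y u) * (c i i * (c j j * c k k - c j k * c k j)
           - c i j * (c j i * c k k - c j k * c k i)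
           + c i k * (c j i * c k j - c j j * c k i)) = 1]].
Proof.
move=> oU Up us sw sX srho closed perp diverg rho0 wip Xkp.
move: (us); rewrite /= !inE !negb_or andbT => /andP[/andP[ij ik] jk].
have [ji ki kj] : [/\ j != i, k != i & k != j] by rewrite ![_ == i]eq_sym [k == j]eq_sym.
have S (F : 'I_3 -> R) : \sum_l F l = F i + F j + F k := sum_ijk F us.
have [r r0 rP] : exists2 r : R, 0 < r & forall z, ball p r z ->
    [/\ U z, w i z != 0 & X k z != 0].
  (* One positive product keeps both [w_i] and [X_k] away from zero near [p]. *)
  have N1 : \forall z \near p, 0 < (w i p * X k p) * (w i z * X k z).
    apply: continuous_gt0; last by rewrite -expr2 exprn_even_gt0//= mulf_neq0.
    apply: continuousM; first exact: cst_continuous.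
    exact: smooth_continuous (smooth_mul oU (sw i) (sX k)) Up.
  have [r /= r0 rP] := iffLR (nbhs_ballP _ _) (@filterI _ _ (nbhs_filter p) _ _
    (open_nbhs_nbhs (conj oU Up)) N1).
  exists r => // z /rP[Uz h]; split=> //; apply: contraTneq h => ->.
    by rewrite mul0r mulr0 ltxx.
  by rewrite !mulr0 ltxx.
have oB : open (ball p r) by exact: ball_open.
have BU : ball p r `<=` U by move=> z /rP[].
have [f sf df] := @poincare R xpredT p r r0 w
  (fun l _ => smooth_sub BU (sw l)) (fun a b z _ _ bz => closed a b z (BU _ bz)).
have Bp : ball p r p by exact: ballxx.
have [|V1 [U1 [y1 [D1 V1p V1B fi0]]]] := straighten oB Bp sf (i := i).
  by rewrite df.
have sf1 : smooth_on V1 f := smooth_sub V1B sf.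
have [oV1 oU1 sx1 sy1 [x1P y1P]] := D1.
set x1 := fun z => set_coord i z (f z) in D1 sx1 x1P y1P.
have [U1p y1p] := x1P p V1p; set p1 := x1 p in U1p y1p.
pose A l := fun z => rho z * X l z.
have sA l : smooth_on U (A l) := smooth_mul oU srho (sX l).
pose q l := fun z => A l z * (w i z)^-1.
have wi0 z : ball p r z -> w i z != 0 by move=> /rP[].
have sq l : smooth_on (ball p r) (q l) := smooth_mul oB (smooth_sub BU (sA l))
  (smooth_inv oB wi0 (smooth_sub BU (sw i))).
have dq z n l : ball p r z -> is_derive z (basis_vect n) (q l)
    ('D_(basis_vect n) (A l) z * (w i z)^-1 +
     A l z * (- 'D_(basis_vect n) (w i) z / w i z ^+ 2)).
  move=> bz; apply: is_derive_mul; first exact: smooth_derivable (sA l) (BU _ bz).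
  apply: is_derive_inv; first by case: (rP _ bz).
  exact: smooth_derivable (sw i) (BU _ bz).
have dqy u m l : U1 u -> m != i -> is_derive u (basis_vect m) (fun y => q l (y1 y))
    (('D_(basis_vect i) (A l) (y1 u) * (w i (y1 u))^-1 +
     A l (y1 u) * (- 'D_(basis_vect i) (w i) (y1 u) / w i (y1 u) ^+ 2)) *
     (- w m (y1 u) / w i (y1 u)) +
     ('D_(basis_vect m) (A l) (y1 u) * (w i (y1 u))^-1 +
     A l (y1 u) * (- 'D_(basis_vect m) (w i) (y1 u) / w i (y1 u) ^+ 2))).
  move=> U1u mi; have [V1y _] := y1P u U1u; have By := V1B _ V1y.
  have h := is_derive_pullback oB V1B sf1 (sq l) D1 U1u fi0 mi (fun n => dq _ n l By).
  by rewrite (df i _ isT By) (df m _ isT By) in h.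
(* Closedness on the leaves of [q_k dx_j - q_j dx_k], the differential prescribed for [g]. *)
have cl u : U1 u -> 'D_(basis_vect j) (fun y => -1 * q j (y1 y)) u =
    'D_(basis_vect k) (fun y => q k (y1 y)) u.
  move=> U1u; have [V1y _] := y1P u U1u; have Uy := BU _ (V1B _ V1y).
  have [_ ->] := dqy u k k U1u ki.
  have [_ ->] := is_derive_mul (@is_derive_cst _ _ _ (-1 : R) u (basis_vect j))
    (dqy u j j U1u ji).
  rewrite mul0r add0r mulN1r; apply: (@leaf_closed (A i (y1 u)) _ _ _ _ _
    ('D_(basis_vect i) (A i) (y1 u))).
  - exact: wi0 (V1B _ V1y).
  - have := perp _ Uy; rewrite S /A => h.
    rewrite -[RHS](mulr0 (rho (y1 u))) -h.
    by move: (rho _) (w i _) (w j _) (w k _) (X i _) (X j _) (X k _) => *; ring.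
  (* The derivative along [x_i] of the identity [w . A = 0], after closedness of [w] has exchanged
     the indices. *)
  - rewrite (closed j i)// (closed k i)//.
    have [_ h] := is_derive_bigsum (fun l => is_derive_mul
      (smooth_derivable i (sw l) Uy) (smooth_derivable i (sA l) Uy)).
    rewrite S in h; apply: etrans (esym h) _.
    rewrite (@near_eq_derive _ _ _ _ (fun=> 0)); first exact: derive_cst.
    apply: near_open oU Uy _ => y Uy'.
    transitivity (rho y * \sum_l w l y * X l y); last by rewrite perp// mulr0.
    by rewrite mulr_sumr; apply: eq_bigr => l _; rewrite /A mulrCA.
  - by have := diverg _ Uy; rewrite S.
pose F l : vect R -> R :=
  if l == j then (fun y => q k (y1 y)) else (fun y => -1 * q j (y1 y)).
have Fj : F j = (fun y => q k (y1 y)) by rewrite /F eqxx.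
have Fk : F k = (fun y => -1 * q j (y1 y)) by rewrite /F (negbTE kj).
have sqy l : smooth_on U1 (fun y => q l (y1 y)) :=
  smooth_comp oB oU1 (fun u Uu => V1B _ (y1P u Uu).1) sy1 (sq l).
have sF l : smooth_on U1 (F l).
  rewrite /F; case: ifP => _; first exact: sqy.
  exact: (smooth_mul oU1 (@smooth_cst R U1 (-1)) (sqy j)).
have [r1 /= r10 r1U] := iffLR (nbhs_ballP _ _) (open_nbhs_nbhs (conj oU1 U1p)).
have oB1 : open (ball p1 r1) by exact: ball_open.
have clF a b z : pred2 j k a -> pred2 j k b -> ball p1 r1 z ->
    'D_(basis_vect a) (F b) z = 'D_(basis_vect b) (F a) z.
  move=> /orP[]/eqP -> /orP[]/eqP -> /r1U Uz; [by []| | |by []].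
    by rewrite Fj Fk; exact: cl.
  by rewrite Fj Fk; exact: esym (cl _ Uz).
(* Only [x_j] and [x_k] are contracted; the coordinate in place [i], now the value of [f], is a
   parameter. *)
have [g sg dg] := @poincare R (pred2 j k) p1 r1 r10 F
  (fun l _ => smooth_sub r1U (sF l)) clF.
have B1p : ball p1 r1 p1 by exact: ballxx.
have dgj u : ball p1 r1 u ->
    'D_(basis_vect j) g u = rho (y1 u) * X k (y1 u) / w i (y1 u).
  by move=> Bu; rewrite dg ?Fj//= eqxx.
have dgk u : ball p1 r1 u ->
    'D_(basis_vect k) g u = - (rho (y1 u) * X j (y1 u) / w i (y1 u)).
  by move=> Bu; rewrite dg ?Fk ?mulN1r//= eqxx orbT.
have [|V2 [U2 [y2 [D2 V2p V2B gj0]]]] := straighten oB1 B1p sg (i := j).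
  by rewrite dgj// y1p !mulf_neq0 ?invr_eq0//; exact: rho0.
have sg1 : smooth_on V2 g := smooth_sub V2B sg.
have [oV2 oU2 sx2 sy2 [x2P y2P]] := D2.
set x2 := fun z => set_coord j z (g z) in D2 sx2 x2P y2P.
have [U2p y2p] := x2P p1 V2p; set p2 := x2 p1 in U2p y2p.
have V2U1 u : U2 u -> U1 (y2 u) by move=> Uu; exact: r1U _ (V2B _ (y2P u Uu).1).
have sXy : smooth_on U2 (fun y => X k (y1 (y2 y))).
  have s1 : smooth_on U1 (fun y => X k (y1 y)) :=
    smooth_comp oB oU1 (fun u Uu => V1B _ (y1P u Uu).1) sy1 (smooth_sub BU (sX k)).
  exact: (smooth_comp oU1 oU2 V2U1 sy2 s1).
have Xk0 z : ball p r z -> X k z != 0 by move=> /rP[].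
have Xy0 u : U2 u -> X k (y1 (y2 u)) != 0.
  by move=> Uu; exact: Xk0 (V1B _ (y1P _ (V2U1 _ Uu)).1).
have sT := smooth_inv oU2 Xy0 sXy.
have [r2 /= r20 r2U] := iffLR (nbhs_ballP _ _) (open_nbhs_nbhs (conj oU2 U2p)).
have oB2 : open (ball p2 r2) by exact: ball_open.
(* With the single coordinate [k] contracted this is a primitive of [1 / X_k] along [x_k], and the
   closedness condition compares an index with itself. *)
have [t st dt] := @poincare R (pred1 k) p2 r2 r20 (fun _ y => (X k (y1 (y2 y)))^-1)
  (fun _ _ => smooth_sub r2U sT)
  (fun a b z ak bk _ => congr1 (fun c => 'D_(basis_vect c) _ z)
     (etrans (eqP ak) (esym (eqP bk)))).
have B2p : ball p2 r2 p2 by exact: ballxx.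
have dtk u : ball p2 r2 u -> 'D_(basis_vect k) t u = (X k (y1 (y2 u)))^-1.
  by move=> Bu; rewrite dt//= eqxx.
have [|V3 [U3 [y3 [D3 V3p V3B tk0]]]] := straighten oB2 B2p st (i := k).
  by rewrite dtk// invr_eq0 Xy0.
have st1 : smooth_on V3 t := smooth_sub V3B st.
have [oV3 oU3 sx3 sy3 [x3P y3P]] := D3.
set x3 := fun z => set_coord k z (t z) in D3 sx3 x3P y3P.
have D123 := diffeo_comp (diffeo_comp D1 D2) D3.
eexists; eexists; eexists; eexists; split; first exact: D123.
- by split; [split|].
- by move=> z [[/V1B/BU]].
move=> u [U3u _].
pose c m l := 'D_(basis_vect m) (fun y' => ((y1 \o y2) \o y3) y' 0 l) u.
have [V3y _] := y3P u U3u; have U2v := r2U _ (V3B _ V3y).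
have [V2y _] := y2P _ U2v; have [V1y _] := y1P _ (V2U1 _ U2v).
have E l m : c m l = \sum_n 'D_(basis_vect n) (fun y => y1 y 0 l) (y2 (y3 u)) *
    (\sum_q 'D_(basis_vect q) (fun y => y2 y 0 n) (y3 u) *
      'D_(basis_vect m) (fun y => y3 y 0 q) u).
  have d3 q : is_derive u (basis_vect m) (fun y => y3 y 0 q)
      ('D_(basis_vect m) (fun y => y3 y 0 q) u) := smooth_derivable m (sy3 q) U3u.
  have d2 n := is_derive_comp_smooth oU2 U2v (sy2 n) d3.
  have [_ d1] := @is_derive_comp_smooth R _ U1 (fun y => y1 y 0 l) (fun y => y2 (y3 y))
    u (basis_vect m) _ oU1 (V2U1 _ U2v) (sy1 l) d2.
  exact: d1.
have Bz := V1B _ V1y.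
have [] := @frame_algebra i j k (fun l => w l (y1 (y2 (y3 u))))
  (fun l => X l (y1 (y2 (y3 u)))) (fun l => 'D_(basis_vect l) g (y2 (y3 u)))
  (fun l => 'D_(basis_vect l) t (y3 u)) (rho (y1 (y2 (y3 u))))
  (fun n l => 'D_(basis_vect n) (fun y => y1 y 0 l) (y2 (y3 u)))
  (fun n l => 'D_(basis_vect n) (fun y => y2 y 0 l) (y3 u))
  (fun n l => 'D_(basis_vect n) (fun y => y3 y 0 l) u) us
  (wi0 _ Bz) (Xk0 _ Bz) (rho0 _ (BU _ Bz)) (perp _ (BU _ Bz))
  (dgj _ (V2B _ V2y)) (dgk _ (V2B _ V2y)) (dtk _ (V3B _ V3y)).
- by move=> n l li; have [h _] := partial_set_coord n sf1 D1 (V2U1 _ U2v) fi0; exact: h.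
- move=> n; have [_ ->] := partial_set_coord n sf1 D1 (V2U1 _ U2v) fi0.
  by rewrite (df n _ isT Bz) (df i _ isT Bz).
- by move=> n l lj; have [h _] := partial_set_coord n sg1 D2 U2v gj0; exact: h.
- by move=> n; have [_ h] := partial_set_coord n sg1 D2 U2v gj0; exact: h.
- by move=> n l lk; have [h _] := partial_set_coord n st1 D3 U3u tk0; exact: h.
- by move=> n; have [_ h] := partial_set_coord n st1 D3 U3u tk0; exact: h.
move=> h1 h2 h3; split.
- move=> m; rewrite -(h1 m); apply: eq_bigr => l _; congr (_ * _).
  exact: E.
- by move=> l; exact: etrans (E l k) (h2 l).
- by rewrite -!/(c _ _) !E; exact: h3.
Qed.

End Flatten.

(** * Tensor fields in the global chart *)

Section Chart.
Variables (R : realType) (B : body R).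
Implicit Types (f g : B -> R) (p q : B) (z v : vect R).

Let U := range (chart B).
Let oU : open U := @chart_open R B.

Lemma chart_range p : range (chart B) (chart B p).
Proof. by exists p. Qed.

Lemma in_chart_cst (c : R) p v : 'D_v (in_chart (fun _ : B => c)) (chart B p) = 0.
Proof.
rewrite (@near_eq_derive _ _ _ _ (fun=> c)); first exact: derive_cst.
by apply: near_open oU (chart_range p) _ => _ [q _ <-]; rewrite in_chartE.
Qed.

Lemma smooth_const_field v : smooth_vector_field (fun _ : B => v).
Proof.
move=> k; apply: smooth_eq oU _ (@smooth_cst R _ (v 0 k)) => _ [q _ <-].
by rewrite in_chartE.
Qed.

Lemma vf_actE (X : vector_field B) f p : smooth_fun_on setT f ->
  vf_act X f p = \sum_l 'D_(basis_vect l) (in_chart f) (chart B p) * X p 0 l.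
Proof.
by move=> sf; have [_] := is_derive_smooth (X p) oU (chart_range p) sf.
Qed.

Lemma vf_act_is_derive (X : vector_field B) f p : smooth_fun_on setT f ->
  is_derive (chart B p) (X p) (in_chart f) (vf_act X f p).
Proof.
move=> sf; have [d _] := is_derive_smooth (X p) oU (chart_range p) sf.
exact: derivableP.
Qed.

Lemma vf_act_eq (X : vector_field B) f p (F : vect R -> R) d :
  (forall q, f q = F (chart B q)) ->
  is_derive (chart B p) (X p) F d -> vf_act X f p = d.
Proof.
move=> fF [_ <-]; apply: near_eq_derive.
by apply: near_open oU (chart_range p) _ => _ [q _ <-]; rewrite in_chartE.
Qed.

Lemma one_formE (omega : one_form B) p v :
  omega p v = \sum_l in_chart (fun q => omega q (basis_vect l)) (chart B p) * v 0 l.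
Proof.
rewrite {1}(row_sum_delta v) linear_sum; apply: eq_bigr => l _.
by rewrite linearZ in_chartE [LHS]mulrC.
Qed.

(** In one direction the coordinate fields are inserted, whose bracket vanishes. In the other, the
    Leibniz rule produces derivatives of the components of [Y] and [Z], and these cancel against
    [omega] of the bracket. *)
Lemma closed_one_formP (omega : one_form B) : smooth_one_form omega ->
  closed_one_form omega <->
  forall a b z, U z ->
    'D_(basis_vect a) (in_chart (fun q => omega q (basis_vect b))) z =
    'D_(basis_vect b) (in_chart (fun q => omega q (basis_vect a))) z.
Proof.
move=> so; split=> [cl a b _ [p _ <-]|cl Y Z sY sZ p].
  have := cl _ _ (smooth_const_field (basis_vect a))
    (smooth_const_field (basis_vect b)) p.
  rewrite /ext_deriv.
  have -> : bracket (fun _ : B => basis_vect a) (fun _ : B => basis_vect b) p = 0.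
    by apply/rowP => k; rewrite !mxE /vf_act !in_chart_cst subrr.
  by rewrite linear0 subr0 => /eqP; rewrite subr_eq0 => /eqP.
pose w l := in_chart (fun q => omega q (basis_vect l)).
have pair (Y' Z' : vector_field B) : smooth_vector_field Y' ->
    smooth_vector_field Z' ->
    vf_act Y' (fun q => omega q (Z' q)) p =
    \sum_l ((\sum_a 'D_(basis_vect a) (w l) (chart B p) * Y' p 0 a) * Z' p 0 l +
            w l (chart B p) * vf_act Y' (fun q => Z' q 0 l) p).
  move=> sY' sZ'.
  pose F z := \sum_l w l z * in_chart (fun q => Z' q 0 l) z.
  apply: (@vf_act_eq _ _ _ F).
    move=> q; rewrite one_formE; apply: eq_bigr => l _.
    by rewrite [in_chart (fun q => Z' q 0 l) _]in_chartE.
  apply: is_derive_bigsum => l.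
  have h := is_derive_mul (vf_act_is_derive Y' p (so l)) (vf_act_is_derive Y' p (sZ' l)).
  by apply: is_derive_eq h _; rewrite vf_actE// [in_chart (fun q => Z' q 0 l) _]in_chartE.
rewrite /ext_deriv !pair// one_formE.
rewrite -!sumrB.
under eq_bigr do rewrite mxE.
rewrite (eq_bigr (fun l => (\sum_a 'D_(basis_vect a) (w l) (chart B p) * Y p 0 a) * Z p 0 l -
  (\sum_a 'D_(basis_vect a) (w l) (chart B p) * Z p 0 a) * Y p 0 l)); last first.
  move=> l _; rewrite -/(w l).
  move: (\sum_a _) (\sum_a _) (w l _) (vf_act _ _ _) (vf_act _ _ _) => *; ring.
rewrite sumrB; apply/eqP; rewrite subr_eq0; apply/eqP.
under eq_bigr do rewrite mulr_suml.
under [RHS]eq_bigr do rewrite mulr_suml.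
rewrite exchange_big; apply: eq_bigr => a _; apply: eq_bigr => l _.
rewrite cl; last exact: chart_range.
by rewrite mulrAC.
Qed.

Definition det3 (i j k : 'I_3) (u v w : vect R) : R :=
  u 0 i * (v 0 j * w 0 k - v 0 k * w 0 j)
  - u 0 j * (v 0 i * w 0 k - v 0 k * w 0 i)
  + u 0 k * (v 0 i * w 0 j - v 0 j * w 0 i).

Lemma linear_ijk (i j k : 'I_3) (F : vect R -> R) v : uniq [:: i; j; k] ->
  linear (F : vect R -> R^o) ->
  F v = v 0 i * F (basis_vect i) + v 0 j * F (basis_vect j) + v 0 k * F (basis_vect k).
Proof.
move=> us lF.
pose L : {linear vect R -> R^o} :=
  HB.pack (F : vect R -> R^o) (GRing.isLinear.Build _ _ _ _ _ lF).
rewrite -(sum_ijk (fun l => v 0 l * F (basis_vect l)) us) {1}(row_sum_delta v).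
transitivity (L (\sum_l v 0 l *: basis_vect l)); first by [].
by rewrite linear_sum; apply: eq_bigr => l _; rewrite linearZ.
Qed.

(** Alternating 3-forms on R^3 form a line: after expansion in all three arguments only the terms
    with distinct indices survive, and transpositions bring them to the order [i], [j], [k]. *)
Lemma alt3E (O : alternating3 R) (i j k : 'I_3) (u v w : vect R) : uniq [:: i; j; k] ->
  O u v w = O (basis_vect i) (basis_vect j) (basis_vect k) * det3 i j k u v w.
Proof.
move=> us.
have add1 a b c d : O (a + b) c d = O a c d + O b c d.
  by have := alt3_linear1 O c d 1 a b; rewrite !scale1r.
have add2 a b c d : O c (a + b) d = O c a d + O c b d.
  by have := alt3_linear2 O c d 1 a b; rewrite !scale1r.
have add3 a b c d : O c d (a + b) = O c d a + O c d b.
  by have := alt3_linear3 O c d 1 a b; rewrite !scale1r.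
have sw12 a b c : O b a c = - O a b c.
  apply/eqP; rewrite -addr_eq0 addrC; apply/eqP.
  by have := alt3_12 O (a + b) c; rewrite add1 !add2 !alt3_12 add0r addr0.
have sw23 a b c : O a c b = - O a b c.
  apply/eqP; rewrite -addr_eq0 addrC; apply/eqP.
  by have := alt3_23 O a (b + c); rewrite add2 !add3 !alt3_23 add0r addr0.
set ei := basis_vect i; set ej := basis_vect j; set ek := basis_vect k.
rewrite (linear_ijk u us (alt3_linear1 O v w)).
rewrite !(linear_ijk v us (alt3_linear2 O _ w)).
rewrite !(linear_ijk w us (alt3_linear3 O _ _)).
rewrite !alt3_12 !alt3_23 !alt3_13 -/ei -/ej -/ek.
have -> : O ej ei ek = - O ei ej ek by rewrite sw12.
have -> : O ei ek ej = - O ei ej ek by rewrite sw23.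
have -> : O ek ej ei = - O ei ej ek by rewrite sw12 sw23 sw12 !opprK.
have -> : O ej ek ei = O ei ej ek by rewrite sw23 sw12 opprK.
have -> : O ek ei ej = O ei ej ek by rewrite sw12 sw23 opprK.
rewrite /det3.
move: (O ei ej ek) (u 0 i) (u 0 j) (u 0 k) (v 0 i) (v 0 j) (v 0 k) (w 0 i) (w 0 j) (w 0 k) => *.
ring.
Qed.

(** The derivative at [s = 0] of [det (1 + s J)] times the determinant of [u], [v], [w]. *)
Lemma det3_trace (i j k : 'I_3) (J : 'I_3 -> 'I_3 -> R) (u v w : vect R) :
  uniq [:: i; j; k] ->
  let N (y : vect R) : vect R := \row_m \sum_l J m l * y 0 l in
  det3 i j k (N u) v w + det3 i j k u (N v) w + det3 i j k u v (N w) =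
  (\sum_l J l l) * det3 i j k u v w.
Proof.
move=> us N; rewrite /det3 /N !mxE !(sum_ijk _ us).
move: (J i i) (J i j) (J i k) (J j i) (J j j) (J j k) (J k i) (J k j) (J k k).
move: (u 0 i) (u 0 j) (u 0 k) (v 0 i) (v 0 j) (v 0 k) (w 0 i) (w 0 j) (w 0 k) => *.
ring.
Qed.

Lemma is_derive_det3 (i j k : 'I_3) (u v w : vect R -> vect R) (u' v' w' : vect R)
    (z d : vect R) :
  (forall l, is_derive z d (fun y => u y 0 l) (u' 0 l)) ->
  (forall l, is_derive z d (fun y => v y 0 l) (v' 0 l)) ->
  (forall l, is_derive z d (fun y => w y 0 l) (w' 0 l)) ->
  is_derive z d (fun y => det3 i j k (u y) (v y) (w y))
    (det3 i j k u' (v z) (w z) + det3 i j k (u z) v' (w z) +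
     det3 i j k (u z) (v z) w').
Proof.
move=> du dv dw.
have dsub (f g : vect R -> R) a b : is_derive z d f a -> is_derive z d g b ->
    is_derive z d (fun y => f y - g y) (a - b).
  by move=> df dg; exact: (@is_deriveB _ _ _ f g).
have dm a b := dsub _ _ _ _ (is_derive_mul (dv a) (dw b)) (is_derive_mul (dv b) (dw a)).
have h := is_derive_add (dsub _ _ _ _ (is_derive_mul (du i) (dm j k))
  (is_derive_mul (du j) (dm i k))) (is_derive_mul (du k) (dm i j)).
apply: is_derive_eq h _; rewrite /det3.
move: (u z 0 i) (u z 0 j) (u z 0 k) (v z 0 i) (v z 0 j) (v z 0 k) (w z 0 i) (w z 0 j) (w z 0 k).
move: (u' 0 i) (u' 0 j) (u' 0 k) (v' 0 i) (v' 0 j) (v' 0 k) (w' 0 i) (w' 0 j) (w' 0 k) => *.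
ring.
Qed.

(** Here [u'] stands for the derivative of a field along [X] and [n1] for the derivative of [X]
    along that field, so that [u' - n1] is their bracket. The primed terms cancel, and the [n] terms
    add up to a trace. *)
Let lie_det3 (i j k : 'I_3) (u u' v v' w w' n1 n2 n3 : vect R) (rho drho t : R) :
  det3 i j k n1 v w + det3 i j k u n2 w + det3 i j k u v n3 = t * det3 i j k u v w ->
  drho * det3 i j k u v w + rho * (det3 i j k u' v w + det3 i j k u v' w +
    det3 i j k u v w') - rho * det3 i j k (u' - n1) v w
  - rho * det3 i j k u (v' - n2) w - rho * det3 i j k u v (w' - n3) =
  (drho + rho * t) * det3 i j k u v w.
Proof.
move=> E; rewrite mulrDl -(mulrA rho) -E /det3 !mxE.
move: (u 0 i) (u 0 j) (u 0 k) (v 0 i) (v 0 j) (v 0 k) (w 0 i) (w 0 j) (w 0 k).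
move: (u' 0 i) (u' 0 j) (u' 0 k) (v' 0 i) (v' 0 j) (v' 0 k) (w' 0 i) (w' 0 j) (w' 0 k).
move: (n1 0 i) (n1 0 j) (n1 0 k) (n2 0 i) (n2 0 j) (n2 0 k) (n3 0 i) (n3 0 j) (n3 0 k) => *.
ring.
Qed.

(** * The Lie derivative of a volume form as a divergence *)

Section LieDerivative.
Variables (X : vector_field B) (Omega : three_form B) (i j k : 'I_3).
Hypothesis us : uniq [:: i; j; k].
Hypothesis sX : smooth_vector_field X.
Hypothesis sO : smooth_three_form Omega.
Let rho := in_chart (fun q => Omega q (basis_vect i) (basis_vect j) (basis_vect k)).
Let Xc l := in_chart (fun q => X q 0 l).

(** The formula [L_X Omega = div(rho X) dx_i /\ dx_j /\ dx_k]: the derivative of [rho] along [X] and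
    [rho] times the trace of the Jacobian of [X] combine into the divergence. *)
Lemma lie_derivE (Y1 Y2 Y3 : vector_field B) p : smooth_vector_field Y1 ->
  smooth_vector_field Y2 -> smooth_vector_field Y3 ->
  lie_deriv X Omega Y1 Y2 Y3 p =
  (\sum_l 'D_(basis_vect l) (fun y => rho y * Xc l y) (chart B p)) *
    det3 i j k (Y1 p) (Y2 p) (Y3 p).
Proof.
move=> sY1 sY2 sY3.
pose Yc (Y : vector_field B) y : vect R := \row_m in_chart (fun q => Y q 0 m) y.
have YcE Y q : Yc Y (chart B q) = Y q by apply/rowP => m; rewrite mxE in_chartE.
pose dY (Y : vector_field B) : vect R := \row_m vf_act X (fun q => Y q 0 m) p.
have dYc Y l : smooth_vector_field Y ->
    is_derive (chart B p) (X p) (fun y => Yc Y y 0 l) (dY Y 0 l).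
  move=> sY; rewrite mxE (_ : (fun y => _) = in_chart (fun q => Y q 0 l)).
    exact: vf_act_is_derive (sY l).
  by apply/funext => y; rewrite mxE.
pose J m l := 'D_(basis_vect l) (Xc m) (chart B p).
pose N (y : vect R) : vect R := \row_m \sum_l J m l * y 0 l.
have brE Y : bracket X Y p = dY Y - N (Y p).
  by apply/rowP => m; rewrite !mxE; congr (_ - _); exact: vf_actE (sX m).
have OE q u v w : Omega q u v w = rho (chart B q) * det3 i j k u v w.
  by rewrite (alt3E _ _ _ _ us) /rho in_chartE.
have dr : is_derive (chart B p) (X p) rho
    (\sum_l 'D_(basis_vect l) rho (chart B p) * X p 0 l).
  exact: is_derive_smooth oU (chart_range p) (sO i j k).
have dF := is_derive_mul dr (is_derive_det3 i j k (fun l => dYc Y1 l sY1)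
  (fun l => dYc Y2 l sY2) (fun l => dYc Y3 l sY3)).
rewrite /lie_deriv (vf_act_eq _ dF); last by move=> q; rewrite OE !YcE.
rewrite !OE !brE !YcE (lie_det3 _ _ _ _ _ (det3_trace J (Y1 p) (Y2 p) (Y3 p) us)).
congr (_ * _); rewrite mulr_sumr -big_split; apply: eq_bigr => l _ /=.
have [_ ->] := is_derive_mul (smooth_derivable l (sO i j k) (chart_range p))
  (smooth_derivable l (sX l) (chart_range p)).
by rewrite in_chartE.
Qed.

Lemma lie_deriv_zeroP : lie_deriv_zero X Omega <->
  forall z, U z -> \sum_l 'D_(basis_vect l) (fun y => rho y * Xc l y) z = 0.
Proof.
split=> [L _ [p _ <-]|L Y1 Y2 Y3 sY1 sY2 sY3 p]; last first.
  by rewrite lie_derivE// L ?mul0r//; exact: chart_range.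
(* On the constant fields [e_i], [e_j], [e_k] the determinant is 1, which isolates the
   divergence. *)
have := L _ _ _ (smooth_const_field (basis_vect i)) (smooth_const_field (basis_vect j))
  (smooth_const_field (basis_vect k)) p.
rewrite lie_derivE; [|exact: smooth_const_field..].
move: us; rewrite /= !inE !negb_or andbT => /andP[/andP[/negbTE ij /negbTE ik] /negbTE jk].
rewrite /det3 !mxE !eqxx /= ![_ == i]eq_sym [k == j]eq_sym ij ik jk.
by rewrite !(mul0r, mulr0, subr0, mulr1, addr0).
Qed.

End LieDerivative.

End Chart.

(** * The two implications *)

Section Main.
Variables (R : realType) (B : body R).
Implicit Types (p q : B) (z v : vect R).
Variables (omega : one_form B) (X : vector_field B) (Omega : three_form B).
Hypotheses (omega_smooth : smooth_one_form omega).
Hypotheses (X_smooth : smooth_vector_field X).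
Hypotheses (Omega_vol : volume_form Omega).

Let U := range (chart B).
Let oU : open U := @chart_open R B.
Let w l := in_chart (fun q => omega q (basis_vect l)).
Let Xc l := in_chart (fun q => X q 0 l).
Let rho i j k := in_chart (fun q => Omega q (basis_vect i) (basis_vect j) (basis_vect k)).

(* [C] and [M] are the Jacobians of a coordinate change and of its inverse. *)
Let dual_frame (i j k : 'I_3) (C M : 'I_3 -> 'I_3 -> R) (ww XX : 'I_3 -> R) (r : R) :
  uniq [:: i; j; k] ->
  (forall a b, \sum_m C m a * M m b = (a == b)%:R) ->
  (forall m, \sum_l ww l * C m l = (m == i)%:R) ->
  (forall l, XX l = C k l) ->
  r * det3 i j k (\row_l C i l) (\row_l C j l) (\row_l C k l) = 1 ->
  (forall l, ww l = M i l) /\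
  [/\ r * XX i = M i j * M j k - M i k * M j j,
      r * XX j = M i k * M j i - M i i * M j k &
      r * XX k = M i i * M j j - M i j * M j i].
Proof.
move=> us CM wC XC rC.
have S (F : 'I_3 -> R) : \sum_l F l = F i + F j + F k := sum_ijk F us.
move: (us); rewrite /= !inE !negb_or andbT => /andP[/andP[/negbTE ij /negbTE ik] /negbTE jk].
have [ji ki kj] : [/\ (j == i) = false, (k == i) = false & (k == j) = false].
  by rewrite ![_ == i]eq_sym [k == j]eq_sym.
split=> [l|].
  transitivity (\sum_a ww a * (\sum_m C m a * M m l)).
    rewrite (bigD1 l)//= CM eqxx mulr1 big1 ?addr0// => a /negbTE al.
    by rewrite CM al mulr0.
  under eq_bigr do rewrite mulr_sumr.
  have E m : \sum_a ww a * (C m a * M m l) = (m == i)%:R * M m l.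
    by rewrite -wC mulr_suml; apply: eq_bigr => a _; rewrite mulrA.
  rewrite exchange_big /= (bigD1 i)//= E eqxx mul1r big1 ?addr0// => m /negbTE mi.
  by rewrite E mi mul0r.
have P a b : C i a * M i b + C j a * M j b + C k a * M k b = (a == b)%:R.
  by rewrite -CM S.
(* The determinant of [M] as the triple product of row [k] with the cross product of rows [i] and
   [j]. It equals [r], because [det C] is inverse to both. *)
pose detM := M k i * (M i j * M j k - M i k * M j j)
  + M k j * (M i k * M j i - M i i * M j k) + M k k * (M i i * M j j - M i j * M j i).
have rM : r = detM.
  have detP : det3 i j k (\row_l C i l) (\row_l C j l) (\row_l C k l) * detM =
     (C i i * M i i + C j i * M j i + C k i * M k i) *
       ((C i j * M i j + C j j * M j j + C k j * M k j) *
        (C i k * M i k + C j k * M j k + C k k * M k k) -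
        (C i j * M i k + C j j * M j k + C k j * M k k) *
        (C i k * M i j + C j k * M j j + C k k * M k j)) -
     (C i i * M i j + C j i * M j j + C k i * M k j) *
       ((C i j * M i i + C j j * M j i + C k j * M k i) *
        (C i k * M i k + C j k * M j k + C k k * M k k) -
        (C i j * M i k + C j j * M j k + C k j * M k k) *
        (C i k * M i i + C j k * M j i + C k k * M k i)) +
     (C i i * M i k + C j i * M j k + C k i * M k k) *
       ((C i j * M i i + C j j * M j i + C k j * M k i) *
        (C i k * M i j + C j k * M j j + C k k * M k j) -
        (C i j * M i j + C j j * M j j + C k j * M k j) *
        (C i k * M i i + C j k * M j i + C k k * M k i)).
    by rewrite /det3 /detM !mxE; ring.
  rewrite !P !eqxx ij ik jk ji ki kj in detP.
  have d1 : det3 i j k (\row_l C i l) (\row_l C j l) (\row_l C k l) * detM = 1.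
    by rewrite detP /=; ring.
  by rewrite -[LHS]mulr1 -d1 mulrA rC mul1r.
(* The cross product of rows [i] and [j] of [M] is orthogonal to both rows, so pairing it with
   [\sum_m C m a * M m] leaves [C k a * detM]. That sum is the [a]-th basis vector, so the pairing
   is also the [a]-th component of the cross product. *)
have col a : r * XX a =
  (M i j * M j k - M i k * M j j) * (C i a * M i i + C j a * M j i + C k a * M k i)
  + (M i k * M j i - M i i * M j k) * (C i a * M i j + C j a * M j j + C k a * M k j)
  + (M i i * M j j - M i j * M j i) * (C i a * M i k + C j a * M j k + C k a * M k k).
  by rewrite XC rM /detM; ring.
by split; rewrite col !P !eqxx ?ij ?ik ?jk ?ji ?ki ?kj !(mulr1, mulr0, addr0, add0r).
Qed.

(** The functions [a] and [b] are the first two adapted coordinates read in the global chart. The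
    frame conditions concern the coordinate vectors; [dual_frame] converts them into conditions on
    the gradients. *)
Let integrable_gradients p :
  integrable_structure (G1C_structure omega X Omega) ->
  exists Vc (a b : vect R -> R), [/\ open Vc, Vc (chart B p), smooth_on Vc a,
    smooth_on Vc b & forall z, Vc z ->
      (forall l, w l z = 'D_(basis_vect l) a z) /\
      [/\ rho 0 1 2 z * Xc 0 z =
            'D_(basis_vect 1) a z * 'D_(basis_vect 2) b z -
            'D_(basis_vect 2) a z * 'D_(basis_vect 1) b z,
          rho 0 1 2 z * Xc 1 z =
            'D_(basis_vect 2) a z * 'D_(basis_vect 0) b z -
            'D_(basis_vect 0) a z * 'D_(basis_vect 2) b z &
          rho 0 1 2 z * Xc 2 z =
            'D_(basis_vect 0) a z * 'D_(basis_vect 1) b z -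
            'D_(basis_vect 1) a z * 'D_(basis_vect 0) b z]].
Proof.
move=> /(_ p)[V [x [y [Vp [oV oxV sx sy yx] fr]]]].
pose xc l := in_chart (fun q => x q 0 l).
exists (chart B @` V), (xc 0), (xc 1); split; [exact: oV|by exists p|exact: sx|exact: sx|].
move=> _ [q Vq <-].
pose xv z : vect R := \row_l xc l z.
have xvE q' : xv (chart B q') = x q' by apply/rowP => l; rewrite mxE /xc in_chartE.
have Vcq : (chart B @` V) (chart B q) by exists q.
pose C m l := 'D_(basis_vect m) (fun u => y u 0 l) (x q).
pose M m l := 'D_(basis_vect l) (xc m) (chart B q).
(* The identity [y (x p) = chart B p], valid on an open set, is differentiated by the chain rule. *)
have CM a b : \sum_m C m a * M m b = (a == b)%:R.
  have dxv m : is_derive (chart B q) (basis_vect b) (fun z => xv z 0 m) (M m b).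
    rewrite (_ : (fun z => _) = xc m); first exact: smooth_derivable (sx m) Vcq.
    by apply/funext => z; rewrite mxE.
  have Wx : (x @` V) (xv (chart B q)) by rewrite xvE; exists q.
  have [_] := is_derive_comp_smooth oxV Wx (sy a) dxv.
  rewrite xvE => <-; rewrite (@near_eq_derive _ _ _ _ (fun z : vect R => z 0 a)).
    by have [_ ->] := is_derive_coord (chart B q) (basis_vect b) a; rewrite mxE eqxx.
  apply: near_open oV Vcq _ => _ [q' Vq' <-].
  by rewrite xvE yx.
have [lf v2 [w0 w1 w2] O1] := fr q Vq.
have us : uniq [:: 0 : 'I_3; 1; 2] by [].
apply: (@dual_frame 0 1 2 C M (fun l => w l (chart B q)) (fun l => Xc l (chart B q)) _ us CM).
- move=> m; have -> : \sum_l w l (chart B q) * C m l = omega q (coordinate_frame x y q m).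
    by rewrite one_formE; apply: eq_bigr => l _; rewrite mxE.
  have := mem_ijk m us.
  by rewrite !inE => /or3P[] /eqP ->; [exact: w0|exact: w1|exact: w2].
- by move=> l; rewrite /Xc in_chartE -v2 mxE.
- by rewrite /rho in_chartE -(alt3E _ _ _ _ us).
Qed.

(** A cross product of two gradients has zero divergence: the second derivatives cancel in pairs
    once they are symmetric. *)
Let div_cross (a0 a1 a2 b0 b1 b2 a01 a10 a02 a20 a12 a21
    b01 b10 b02 b20 b12 b21 : R) :
  a10 = a01 -> a20 = a02 -> a21 = a12 -> b10 = b01 -> b20 = b02 -> b21 = b12 ->
  a01 * b2 + a1 * b02 - (a02 * b1 + a2 * b01) +
  (a12 * b0 + a2 * b10 - (a10 * b2 + a0 * b12)) +
  (a20 * b1 + a0 * b21 - (a21 * b0 + a1 * b20)) = 0.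
Proof. by move=> -> -> -> -> -> ->; ring. Qed.

Lemma pde_of_integrable : integrable_structure (G1C_structure omega X Omega) ->
  closed_one_form omega /\ lie_deriv_zero X Omega.
Proof.
move=> int; have us : uniq [:: 0 : 'I_3; 1; 2] by [].
split.
  apply/(closed_one_formP omega_smooth) => l m _ [p _ <-].
  have [Vc [a [b [oV Vp sa sb ab]]]] := integrable_gradients p int.
  have wE n z : Vc z -> w n z = 'D_(basis_vect n) a z by move=> /ab[->].
  rewrite -/(w l) -/(w m) (@near_eq_derive _ _ _ (w m) ('D_(basis_vect m) a)).
    rewrite (partialC m l oV sa Vp); apply: near_eq_derive.
    by apply: near_open oV Vp _ => z Vz; rewrite wE.
  by apply: near_open oV Vp _ => z Vz; rewrite wE.
apply/(lie_deriv_zeroP us X_smooth Omega_vol.1) => _ [p _ <-].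
have [Vc [a [b [oV Vp sa sb ab]]]] := integrable_gradients p int.
rewrite (sum_ijk _ us).
have D (F : vect R -> R) l m n d : (forall z, Vc z -> F z =
    'D_(basis_vect m) a z * 'D_(basis_vect n) b z -
    'D_(basis_vect n) a z * 'D_(basis_vect m) b z) ->
    d = ('D_(basis_vect l) ('D_(basis_vect m) a) (chart B p) * 'D_(basis_vect n) b (chart B p) +
    'D_(basis_vect m) a (chart B p) * 'D_(basis_vect l) ('D_(basis_vect n) b) (chart B p)) -
    ('D_(basis_vect l) ('D_(basis_vect n) a) (chart B p) * 'D_(basis_vect m) b (chart B p) +
    'D_(basis_vect n) a (chart B p) * 'D_(basis_vect l) ('D_(basis_vect m) b) (chart B p)) ->
    'D_(basis_vect l) F (chart B p) = d.
  move=> FE ->.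
  have dd f h : smooth_on Vc f -> is_derive (chart B p) (basis_vect l)
      ('D_(basis_vect h) f) ('D_(basis_vect l) ('D_(basis_vect h) f) (chart B p)).
    by move=> sf; exact: smooth_derivable (smooth_partial h sf) Vp.
  have [_ <-] := @is_deriveB _ _ _ _ _ _ _ _ _
    (is_derive_mul (dd a m sa) (dd b n sb)) (is_derive_mul (dd a n sa) (dd b m sb)).
  by apply: near_eq_derive; apply: near_open oV Vp _ => z Vz; rewrite FE.
have E0 := D (fun y => rho 0 1 2 y * Xc 0 y) 0 1 2 _
  (fun z Vz => let: conj _ (And3 h _ _) := ab z Vz in h) erefl.
have E1 := D (fun y => rho 0 1 2 y * Xc 1 y) 1 2 0 _
  (fun z Vz => let: conj _ (And3 _ h _) := ab z Vz in h) erefl.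
have E2 := D (fun y => rho 0 1 2 y * Xc 2 y) 2 0 1 _
  (fun z Vz => let: conj _ (And3 _ _ h) := ab z Vz in h) erefl.
apply: etrans (congr2 +%R (congr2 +%R E0 E1) E2) _.
exact: div_cross (partialC 0 1 oV sa Vp) (partialC 0 2 oV sa Vp)
  (partialC 1 2 oV sa Vp) (partialC 0 1 oV sb Vp) (partialC 0 2 oV sb Vp)
  (partialC 1 2 oV sb Vp).
Qed.

(** A linear relation between the vectors, inserted in one argument of [O], loses its other two
    terms by alternation, so each coefficient vanishes. Linear independence of a frame thus comes
    from its volume. *)
Lemma alt3_row_free (O : alternating3 R) (v : frame R) : O (v 0) (v 1) (v 2) != 0 ->
  linear_frame v.
Proof.
move=> O0; apply: inj_row_free => c cv.
have us : uniq [:: 0 : 'I_3; 1; 2] by [].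
have E : c 0 0 *: v 0 + c 0 1 *: v 1 + c 0 2 *: v 2 = 0.
  apply/rowP => l; have /rowP/(_ l) := cv; rewrite !mxE (sum_ijk _ us) !mxE => <-.
  by [].
have lin (F : vect R -> R) : linear (F : vect R -> R^o) ->
    c 0 0 * F (v 0) + c 0 1 * F (v 1) + c 0 2 * F (v 2) = 0.
  move=> lF; pose L : {linear vect R -> R^o} :=
    HB.pack (F : vect R -> R^o) (GRing.isLinear.Build _ _ _ _ _ lF).
  transitivity (L (c 0 0 *: v 0 + c 0 1 *: v 1 + c 0 2 *: v 2)).
    by rewrite !linearD !linearZ.
  by rewrite E linear0.
have c0 : c 0 0 = 0.
  have := lin _ (alt3_linear1 O (v 1) (v 2)).
  rewrite alt3_12 alt3_13 !mulr0 !addr0 => /eqP.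
  by rewrite mulf_eq0 (negbTE O0) orbF => /eqP.
have c1 : c 0 1 = 0.
  have := lin _ (alt3_linear2 O (v 0) (v 2)).
  rewrite alt3_12 alt3_23 !mulr0 addr0 add0r => /eqP.
  by rewrite mulf_eq0 (negbTE O0) orbF => /eqP.
have c2 : c 0 2 = 0.
  have := lin _ (alt3_linear3 O (v 0) (v 1)).
  rewrite alt3_13 alt3_23 !mulr0 !add0r => /eqP.
  by rewrite mulf_eq0 (negbTE O0) orbF => /eqP.
apply/rowP => l; rewrite mxE.
by have := mem_ijk l us; rewrite !inE => /or3P[] /eqP ->.
Qed.

Let third (i k : 'I_3) : i != k -> exists j, uniq [:: i; j; k].
Proof.
move=> ik; have [j /andP[ji jk]] : exists j, (j != i) && (j != k).
  apply/existsP; apply: contraT; rewrite negb_exists => /forallP h.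
  have : (#|'I_3| <= #|pred2 i k|)%N.
    apply: subset_leq_card; apply/fintype.subsetP => j _; rewrite !inE.
    by have := h j; rewrite negb_and !negbK.
  by rewrite card_ord card2 ik.
by exists j; rewrite /= !inE negb_or eq_sym ji ik jk.
Qed.

Lemma integrable_of_pde : nowhere_zero_one_form omega ->
  nowhere_zero_vector_field X -> (forall p, omega p (X p) = 0) ->
  closed_one_form omega -> lie_deriv_zero X Omega ->
  integrable_structure (G1C_structure omega X Omega).
Proof.
move=> onz Xnz oX cl lie p.
have [i wi] : exists i, w i (chart B p) != 0.
  apply/existsP; apply: contraT; rewrite negb_exists => /forallP h.
  have [v] := onz p; rewrite one_formE big1 ?eqxx// => l _.
  have := h l; rewrite negbK => /eqP; rewrite /w => ->.
  by rewrite mul0r.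
have perp q : \sum_l w l (chart B q) * Xc l (chart B q) = 0.
  transitivity (omega q (X q)); last exact: oX.
  rewrite one_formE; apply: eq_bigr => l _.
  by rewrite /Xc in_chartE.
(* If all components of [X] other than the [i]-th vanished, [omega(X) = 0] would reduce to
   [w_i X_i = 0] and force [X = 0]. *)
have [k ki Xk] : exists2 k, k != i & Xc k (chart B p) != 0.
  have [/existsP[k /andP[ki Xk]]|] := boolP [exists k, (k != i) && (Xc k (chart B p) != 0)].
    by exists k.
  rewrite negb_exists => /forallP h; have /negP[] := Xnz p.
  have h0 k : k != i -> Xc k (chart B p) = 0.
    by move=> ki; have := h k; rewrite ki /= negbK => /eqP.
  have Xi : Xc i (chart B p) = 0.
    have := perp p; rewrite (bigD1 i)//= big1 ?addr0 => [/eqP|l li]; last first.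
      by rewrite h0// mulr0.
    by rewrite mulf_eq0 (negbTE wi) /= => /eqP.
  apply/eqP/rowP => l; rewrite mxE -[LHS](in_chartE (fun q => X q 0 l)).
  by have [->|/h0] := eqVneq l i.
have ik : i != k by rewrite eq_sym.
have [j us] := third ik.
have diverg := iffLR (lie_deriv_zeroP us X_smooth Omega_vol.1) lie.
have rho0 z : U z -> rho i j k z != 0.
  move=> [q _ <-]; have [u [v [v' O0]]] := Omega_vol.2 q.
  apply: contra_neq O0; rewrite /rho in_chartE (alt3E _ u v v' us) => ->.
  by rewrite mul0r.
have [V' [W' [x' [y' [D' V'p V'U fr]]]]] := flat_coordinates oU (chart_range p) us
  (fun l => omega_smooth l) (fun l => X_smooth l) (Omega_vol.1 i j k)
  (iffLR (closed_one_formP omega_smooth) cl)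
  (fun z Uz => let: ex_intro2 q _ e := Uz in
     eq_ind _ (fun z => \sum_l w l z * Xc l z = 0) (perp q) _ e)
  diverg rho0 wi Xk.
(* The flat coordinates sit in places [i], [j], [k], while the structure asks for places 0, 1, 2;
   [idx] and [sig] are the inverse permutations between the two. *)
pose idx (l : 'I_3) : 'I_3 := if l == i then 0 else if l == j then 1 else 2.
pose sig (m : 'I_3) : 'I_3 := if m == 0 then i else if m == 1 then j else k.
move: (us); rewrite /= !inE !negb_or andbT => /andP[/andP[/negbTE ij _] /negbTE jk].
have idxi : idx i = 0 by rewrite /idx eqxx.
have idxj : idx j = 1 by rewrite /idx eq_sym ij eqxx.
have idxk : idx k = 2 by rewrite /idx (negbTE ki) eq_sym jk.
have sigK m : idx (sig m) = m.
  by have := @mem_ijk 0 1 2 m erefl; rewrite !inE => /or3P[] /eqP ->.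
have idxK l : sig (idx l) = l.
  have := mem_ijk l us; rewrite !inE.
  by move=> /or3P[] /eqP ->; rewrite ?idxi ?idxj ?idxk.
pose pi z : vect R := \row_m z 0 (sig m).
pose tau v : vect R := \row_l v 0 (idx l).
have Dperm : diffeo setT setT pi tau.
  split; [exact: openT|exact: openT| | |split].
  - move=> m; rewrite (_ : (fun z => _) = (fun z => z 0 (sig m))).
      exact: smooth_coord.
    by apply/funext => z; rewrite mxE.
  - move=> m; rewrite (_ : (fun z => _) = (fun z => z 0 (idx m))).
      exact: smooth_coord.
    by apply/funext => z; rewrite mxE.
  - by move=> z _; split=> //; apply/rowP => l; rewrite !mxE idxK.
  - by move=> z _; split=> //; apply/rowP => l; rewrite !mxE sigK.
have [oV oW sx sy [xP yP]] := diffeo_comp D' Dperm.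
set V := V' `&` _ in oV sx xP yP; set W := setT `&` _ in oW sy xP yP.
set x := pi \o x' in sx xP yP; set y := y' \o tau in sy xP yP.
pose Vb := [set q | V (chart B q)].
have VbE : chart B @` Vb = V.
  apply/seteqP; split=> [_ [q Vq <-] //|z Vz].
  by have [q _ qz] := V'U z Vz.1; exists q; rewrite //= /Vb /= qz.
have WE : (fun q => x (chart B q)) @` Vb = W.
  apply/seteqP; split=> [_ [q Vq <-]|u Wu]; first exact: (xP _ Vq).1.
  have [Vy xy] := yP u Wu; have [q _ qz] := V'U _ Vy.1.
  by exists q; rewrite /= /Vb /= qz.
exists Vb, (fun q => x (chart B q)), y; split; first by split.
  split; rewrite /body_open ?VbE ?WE//.
    move=> l; rewrite /smooth_fun_on VbE; apply: (smooth_eq oV _ (sx l)) => z Vz.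
    by have [q _ <-] := V'U z Vz.1; rewrite in_chartE.
  by move=> q Vq; exact: (xP _ Vq).2.
move=> q Vq; have [Wu yu] := xP _ Vq; set u := x (chart B q) in Wu yu.
have [oV' oW' _ sy' _] := D'.
have W'u : W' (tau u) by case: Wu.
have frE m : coordinate_frame (fun q => x (chart B q)) y q m =
    \row_l 'D_(basis_vect (sig m)) (fun z => y' z 0 l) (tau u).
  apply/rowP => l; rewrite !mxE.
  have dtau a : is_derive u (basis_vect m) (fun v => tau v 0 a) ((a == sig m)%:R : R).
    rewrite (_ : (fun v => _) = (fun v : vect R => v 0 (idx a))); last first.
      by apply/funext => v; rewrite mxE.
    apply: is_derive_eq (is_derive_coord u (basis_vect m) (idx a)) _.
    by rewrite mxE eqxx /= -{1}(sigK m) (can_eq idxK).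
  have [_ E] := is_derive_comp_smooth oW' W'u (sy' l) dtau.
  apply: etrans E _; rewrite (bigD1 (sig m))//= eqxx mulr1 big1 ?addr0//.
  by move=> a /negbTE ->; rewrite mulr0.
have := fr _ W'u; rewrite /= -[y' (tau u)]/(y u) yu => -[fw fX fO].
move: (coordinate_frame _ y q) frE => v frE.
have vE m l : v m 0 l = 'D_(basis_vect (sig m)) (fun z => y' z 0 l) (tau u).
  by rewrite frE mxE.
have v0 l : v 0 0 l = 'D_(basis_vect i) (fun z => y' z 0 l) (tau u) := vE 0 l.
have v1 l : v 1 0 l = 'D_(basis_vect j) (fun z => y' z 0 l) (tau u) := vE 1 l.
have v2 l : v 2 0 l = 'D_(basis_vect k) (fun z => y' z 0 l) (tau u) := vE 2 l.
(* The arguments of [Omega] keep their order; only the basis in which they are expanded is listed as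
   [i], [j], [k], which matches [rho i j k] without a sign. *)
have OE : Omega q (v 0) (v 1) (v 2) = 1.
  rewrite (alt3E _ (v 0) (v 1) (v 2) us) -fO /rho in_chartE.
  by rewrite /det3 !v0 !v1 !v2.
split=> //.
- by apply: (@alt3_row_free (Omega q)); rewrite OE oner_eq0.
- rewrite frE; apply/rowP => l; rewrite mxE -[RHS](in_chartE (fun q => X q 0 l)).
  exact: fX.
- have wv m : omega q (v m) = (sig m == i)%:R.
    by rewrite one_formE -fw; apply: eq_bigr => l _; rewrite frE mxE.
  by split; rewrite wv /sig /= ?eqxx// ?[_ == i]eq_sym ?ij ?(negbTE ik).
Qed.

End Main.

Theorem proposition6p8 (R : realType) (B : body R)
  (omega : one_form B) (X : vector_field B) (Omega : three_form B)
  (omega_smooth : smooth_one_form omega)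
  (omega_nz : nowhere_zero_one_form omega)
  (X_smooth : smooth_vector_field X)
  (X_nz : nowhere_zero_vector_field X)
  (omegaX : forall p, omega p (X p) = 0)
  (Omega_vol : volume_form Omega) :
  integrable_structure (G1C_structure omega X Omega) <->
  closed_one_form omega /\ lie_deriv_zero X Omega.
Proof.
split; first exact: pde_of_integrable.
by case=> cl lie; exact: integrable_of_pde.
Qed.
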